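(* Let $S\subset\mathbb{R}^n$ be a regular $n$-dimensional simplex, and let $$c(S,S^H):=\max_{H}\ \frac{\mathrm{Vol}_n(\mathrm{conv}(S\cup S^H))}{\mathrm{Vol}_n(S)},$$ where the maximum is taken over all supporting hyperplanes $H$ of $S$ and $S^H$ denotes the reflected image of $S$ in $H$. (i) If $1\le n\leq 4$, then $c(S,S^H)=2n$. This maximum is attained only in the case when $u=u_0$, that is, when $H$ passes through a vertex $s_0$ of $S$ and is orthogonal to the height of $S$ at that vertex. (ii) If $n=5$, then $$c(S,S^H)=10\left(\frac{1}{2}+\frac{\sqrt{77}}{10\sqrt{3}}\right)>10=2n .$$
   Context: A supporting hyperplane of $S$ is a hyperplane $H$ that meets $S$ and has $S$ contained in one of its two closed half-spaces. $S^H$ is the image of $S$ under orthogonal reflection in $H$, $\mathrm{conv}$ denotes convex hull, and $\mathrm{Vol}_n$ is $n$-dimensional volume. For a supporting hyperplane $H$ of $S$, label the vertices $s_0,s_1,\dots,s_n$ of $S$ so that $s_0\in H$, and place the origin at $s_0$ (so $s_0=0$). Then $u$ denotes the unit normal vector of $H$ directed towards the half-space containing $S$, $s:=\sum_{i=1}^n s_i$, and $u_0:=s/\|s\|$ is the unit vector pointing from $s_0$ along the height of $S$ at $s_0$ (the line through $s_0$ orthogonal to the opposite facet). *)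

(* Defs.v *)
From HB Require Import structures.
From mathcomp Require Import all_boot all_order all_algebra.
From mathcomp Require Import all_classical all_reals all_analysis.

Set Implicit Arguments.
Unset Strict Implicit.
Unset Printing Implicit Defensive.

Import Order.TTheory GRing.Theory Num.Theory.
Import numFieldNormedType.Exports.

Local Open Scope classical_set_scope.
Local Open Scope ring_scope.

Section Volume.
Variable R : realType.

(* The n-fold product of the one-dimensional Lebesgue measure, i.e. Lebesgue
   measure on R^n, with R^n represented as [n.-tuple R]. The product [\x] is
   the library's product of (set functions underlying) measures. *)
Fixpoint lebesgue_tuple (n : nat) : set (n.-tuple (measurableTypeR R)) -> \bar R :=
  match n with
  | 0 => \d_([tuple] : 0.-tuple (measurableTypeR R))
  | m.+1 => pushforward (@lebesgue_measure R \x @lebesgue_tuple m)%E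
              (fun p => [tuple of p.1 :: p.2])
  end.

Definition vol (n : nat) (A : set 'rV[R]_n) : \bar R :=
  lebesgue_tuple [set t : n.-tuple (measurableTypeR R) | A (\row_i tnth t i)].

End Volume.

Section Euclidean.
Variables (R : realType) (n : nat).
Implicit Types (u v x : 'rV[R]_n) (d : R) (A : set 'rV[R]_n).

Definition dot u v : R := \sum_(i < n) u 0 i * v 0 i.

(* The library norm [`| x |] on row vectors is the sup norm. *)
Definition enorm x : R := Num.sqrt (dot x x).

Definition conv_hull A : set 'rV[R]_n :=
  smallest (@convex_set R 'rV[R]_n) A.

Definition hyperplane u d : set 'rV[R]_n := [set x | dot u x = d].

Definition upper_halfspace u d : set 'rV[R]_n := [set x | d <= dot u x].
Definition lower_halfspace u d : set 'rV[R]_n := [set x | dot u x <= d].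

(* Hyperplanes are parametrized by a unit normal [u] and an offset [d];
   [(u, d)] and [(- u, - d)] give the same hyperplane. *)
Definition supporting A u d : Prop :=
  [/\ enorm u = 1, hyperplane u d `&` A !=set0 &
      A `<=` upper_halfspace u d \/ A `<=` lower_halfspace u d].

(* Orthogonal reflection in [hyperplane u d], for [u] of norm 1. *)
Definition reflection u d x : 'rV[R]_n := x - (2 * (dot u x - d)) *: u.

Definition vol_ratio A u d : \bar R :=
  (vol (conv_hull (A `|` reflection u d @` A)) / vol A)%E.

Definition vol_ratios A : set (\bar R) :=
  [set r | exists u d, supporting A u d /\ r = vol_ratio A u d].

End Euclidean.

Section Simplex.
Variables (R : realType) (n : nat).
Implicit Type s : 'I_n.+1 -> 'rV[R]_n.

Definition affinely_independent s : Prop :=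
  row_free (\matrix_(i < n) (s (lift ord0 i) - s ord0)).

Definition regular_simplex_vertices s : Prop :=
  affinely_independent s /\
  exists a : R, forall i j, i != j -> enorm (s i - s j) = a.

Definition simplex s : set 'rV[R]_n := conv_hull (range s).

(* Unit vector from the vertex [s i] along the height of the simplex at it. *)
Definition height_dir s (i : 'I_n.+1) : 'rV[R]_n :=
  let v := \sum_(j < n.+1 | j != i) (s j - s i) in (enorm v)^-1 *: v.

End Simplex.

Definition is_max (R : realType) (E : set (\bar R)) (c : \bar R) : Prop :=
  E c /\ ubound E c.

(* Main.v *)
Require Import Defs.
From HB Require Import structures.
From mathcomp Require Import all_boot all_order all_algebra.
From mathcomp Require Import all_classical all_reals all_analysis.
From mathcomp Require Import measurable_realfun ring lra.

Set Implicit Arguments.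
Unset Strict Implicit.
Unset Printing Implicit Defensive.

Import Order.TTheory GRing.Theory Num.Theory.
Import numFieldNormedType.Exports.

Local Open Scope classical_set_scope.
Local Open Scope ring_scope.

(** Let h_j >= 0 be the distance from the vertex s_j of the simplex S to the
    supporting hyperplane with unit normal u, and let m be the mean of the n + 1
    numbers h_j; some h_j is 0.

    The hull K of S and its mirror image is the union of the segments joining the
    points of S to their mirror images, since this union is already convex
    ([conv_hull_reflectionE]). Moving upwards, a point of K leaves S through a
    facet; for a regular simplex the facet opposite to s_i can be an exit exactly
    when h_i < m. So K splits into prisms of direction u over these facets, which
    overlap in null sets ([conv_hull_reflection_prisms]). The volume of a prism is
    an affine function of the heights of its edges: it is cut into slabs, each an
    affine image of S under a map of known determinant ([vol_prism]). As u is a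
    unit vector, half the squared edge length is the sum of the (h_j - m)^2, and
    the volume ratio is the quotient

      2 * (sum over h_i < m of (m - h_i) * (sum over j <> i of h_j))
        / (sum over j of (h_j - m)^2)

    ([vol_ratio_heights]). Every nonconstant family of nonnegative numbers that
    contains 0 occurs, up to scaling, as a family of heights
    ([exists_direction]), so the theorem is a statement about this quotient.

    Put y_i = m - h_i, so that the y_i add up to 0 and their maximum is m. Let k of
    them be positive, with sum P and sum of squares Q, and let Q' be the sum of the
    squares of the l = n + 1 - k others. The quotient is 2 (n m P + Q) / (Q + Q'),
    where Cauchy-Schwarz gives P^2 <= l Q' and (P - m)^2 <= (k - 1) (Q - m^2).
    For k = 1 this bounds the quotient by 2n, with equality only if all heights
    but one are equal, that is, if u points along the height at s_i
    ([extremal_direction]). For n <= 4 and k >= 2 a positive definite quadratic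
    form makes the quotient smaller than 2n ([ratio_bound_le4]). For n = 5 and
    k = 2 it can be larger, and its maximum is the number c for which the
    discriminant of the corresponding form vanishes ([ratio_bound_5],
    [height_ratio_two_below]).

    The measure-theoretic input is that an invertible affine map multiplies
    volumes by the absolute value of its determinant ([scales_vol_affine]). It is
    proved by induction on the dimension with Fubini, and it implies that
    hyperplanes are null ([vol_hyperplane0]). *)

(** * Lebesgue measure on tuples *)

Lemma measurable_forall d (T : measurableType d) (I : finType) (F : I -> set T) :
  (forall i, measurable (F i)) -> measurable [set t | forall i, F i t].
Proof.
move=> mF; rewrite (_ : mkset _ = \bigcap_(i in [set: I]) F i).
  by apply: fin_bigcap_measurable => // _; exact: finite_finset.
by apply/seteqP; split => t /= h i; [move=> _; exact: h|exact: h].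
Qed.

Section LebesgueTuple.
Variable R : realType.
Local Notation mR := (measurableTypeR R).

Definition tuple_cons n (p : mR * n.-tuple mR) : n.+1.-tuple mR :=
  [tuple of p.1 :: p.2].

Lemma measurable_tuple_cons n : measurable_fun setT (@tuple_cons n).
Proof. exact: measurable_cons. Qed.

(** The boxes are an exhaustion by sets of finite measure; they also bound the
    volume of every bounded set. *)
Definition tuple_box n (r : R) : set (n.-tuple mR) :=
  [set t | forall i, `[- r, r]%classic (tnth t i)].

Lemma measurable_tuple_box n r : measurable (@tuple_box n r).
Proof.
apply: measurable_forall => i; rewrite -[X in measurable X]setTI.
by apply: measurable_tnth => //; exact: measurable_itv.
Qed.

Lemma tuple_box_cons n r :
  @tuple_cons n @^-1` tuple_box r = `[- r, r]%classic `*` tuple_box r.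
Proof.
apply/seteqP; split => -[x t] /=.
  move=> h; split=> [|i]; first exact: (h ord0).
  by have := h (lift ord0 i); rewrite tnthS.
by move=> [hx ht] i; case: (unliftP ord0 i) => [j ->|-> //]; rewrite tnthS; exact: ht.
Qed.

(** [lebesgue_tuple] is a bare set function; this equality with a structured
    measure is what makes the theory of measures applicable to it. *)
Lemma lebesgue_tuple_measure n :
  exists mu : {sigma_finite_measure set (n.-tuple mR) -> \bar R},
    lebesgue_tuple (R := R) (n := n) = mu :> (set (n.-tuple mR) -> \bar R) /\
    forall r, (mu (tuple_box r) < +oo)%E.
Proof.
elim: n => [|n [mu [muE mub]]].
  exists (\d_([tuple] : 0.-tuple mR)); split=> // r /=.
  by rewrite diracE; case: (_ \in _); rewrite ltry.
pose P : {measure set (mR * n.-tuple mR)%type -> \bar R} :=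
  [the {measure set _ -> \bar R} of (lebesgue_measure \x mu)%E].
pose nu := measure_function_pushforward__canonical__measure_function_Measure P
  (@measurable_tuple_cons n).
have nub r : (nu (tuple_box r) < +oo)%E.
  rewrite /= /pushforward tuple_box_cons product_measure1E //.
  - by rewrite lte_mul_pinfty //= lebesgue_measure_itv /=; case: ifP.
  - exact: measurable_tuple_box.
have sfin : sigma_finite setT nu.
  exists (fun k => tuple_box k%:R).
    apply/esym/seteqP; split => // t _.
    have [k hk] : exists k : nat, forall i, `|tnth t i| <= k%:R.
      exists (Num.bound (\sum_i `|tnth t i|)) => i.
      apply: (@le_trans _ _ (\sum_i `|tnth t i|)).
        by rewrite (bigD1 i) //= lerDl sumr_ge0.
      by apply/ltW/archi_boundP/sumr_ge0.
    by exists k => // i; rewrite /= in_itv /= -ler_norml.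
  by move=> k; split; [exact: measurable_tuple_box|exact: nub].
pose nuS : {sigma_finite_measure set (n.+1.-tuple mR) -> \bar R} :=
  HB.pack (Measure.sort nu) (Measure.class nu)
  (Measure_isSigmaFinite.Build _ _ _ nu sfin).
by exists nuS; split=> //=; rewrite /= muE.
Qed.
End LebesgueTuple.

(** * Volume as an iterated integral *)

Section Scaling.
Variable R : realType.
Local Notation mR := (measurableTypeR R).

(** By uniqueness of the Lebesgue measure: the two sides agree on half-open
    intervals. *)
Lemma lebesgue_measure_affine (a b : R) (B : set mR) : a != 0 -> measurable B ->
  lebesgue_measure [set x : mR | B (a * x + b)] =
  (`|a|^-1%:E * lebesgue_measure B)%E.
Proof.
move=> a0 mB.
pose f (x : mR) : mR := a * x + b.
have mf : measurable_fun setT f.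
  by apply: measurable_funD => //; apply: measurable_funM.
have na : (0 <= `|a|) by [].
pose nu := mscale (NngNum na)
  (measure_function_pushforward__canonical__measure_function_Measure lebesgue_measure mf).
have key : forall X, measurable X ->
    lebesgue_measure X = (`|a|%:E * lebesgue_measure (f @^-1` X))%E.
  apply: (@lebesgue_measure_unique R nu) => _ [[p q]] _ <-.
  rewrite /nu /= /mscale /= /pushforward lebesgue_measure_itv /=.
  have /orP[a_neg|a_pos] : (a < 0) || (0 < a) by rewrite -neq_lt.
    rewrite (_ : f @^-1` _ = `[(q - b) / a, (p - b) / a[%classic); last first.
      apply/seteqP; split=> x /=; rewrite !in_itv /= /f;
      by rewrite ler_ndivrMr // ltr_ndivlMr // (mulrC x) ltrBlDr lerBrDr andbC.
    rewrite lebesgue_measure_itv /= !lte_fin ltr_ndivrMr // divfK //.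
    rewrite ltrD2r; case: ifP => _; rewrite ?mule0 //.
    rewrite -EFinB -EFinB -EFinM ltr0_norm //; congr EFin; field; lra.
  rewrite (_ : f @^-1` _ = `](p - b) / a, (q - b) / a]%classic); last first.
    apply/seteqP; split=> x /=; rewrite !in_itv /= /f;
    by rewrite ltr_pdivrMr // ler_pdivlMr // (mulrC x) ltrBlDr lerBrDr.
  rewrite lebesgue_measure_itv /= !lte_fin ltr_pdivrMr // divfK //.
  rewrite ltrD2r; case: ifP => _; rewrite ?mule0 //.
  rewrite -EFinB -EFinB -EFinM gtr0_norm //; congr EFin; field; lra.
by rewrite [in RHS](key _ mB) muleA -EFinM mulVf ?normr_eq0 // mul1e.
Qed.

(** The domain on which [vol] behaves as a measure. *)
Definition row_measurable n (A : set 'rV[R]_n) :=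
  measurable [set t : n.-tuple mR | A (\row_i tnth t i)].

Lemma row_measurable_halfspace n (f : 'rV[R]_n) c :
  row_measurable [set x | c <= dot f x].
Proof.
pose g (t : n.-tuple mR) : mR := \sum_(i < n) f 0 i * tnth t i.
have mg : measurable_fun setT g.
  apply: measurable_sum => i; apply: measurable_funM => //.
  exact: measurable_tnth.
rewrite /row_measurable (_ : mkset _ = g @^-1` `[c, +oo[%classic).
  by rewrite -[X in measurable X]setTI; apply: mg => //; exact: measurable_itv.
have gE t : g t = dot f (\row_i tnth t i) by apply: eq_bigr => i _; rewrite mxE.
by apply/seteqP; split=> t /=; rewrite in_itv /= andbT gE.
Qed.

Lemma row_measurable_affine m n (M : 'M[R]_(m, n)) b (A : set 'rV[R]_n) :
  row_measurable A -> row_measurable [set x | A (x *m M + b)].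
Proof.
move=> mA.
pose f (t : m.-tuple mR) : n.-tuple mR :=
  [tuple \sum_j tnth t j * M j i + b 0 i | i < n].
have mf : measurable_fun setT f.
  apply/measurable_fun_tnthP => i.
  rewrite (_ : _ \o _ = fun t => \sum_j tnth t j * M j i + b 0 i); last first.
    by apply/funext => t /=; rewrite tnth_mktuple.
  apply: measurable_funD => //; apply: measurable_sum => j.
  by apply: measurable_funM => //; exact: measurable_tnth.
rewrite /row_measurable; have := mf measurableT _ mA; rewrite setTI.
congr (measurable _); apply/funext => t /=; congr (A _).
apply/rowP => i; rewrite !mxE tnth_mktuple; congr (_ + _).
by apply: eq_bigr => j _; rewrite mxE.
Qed.

Let row_cons n (x : R) (t : n.-tuple mR) :
  \row_i tnth (tuple_cons (x, t)) i = row_mx x%:M (\row_i tnth t i) :> 'rV_(1 + n).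
Proof.
apply/rowP => i; rewrite -[i]splitK; case: (fintype.split i) => j /=.
  rewrite row_mxEl !mxE !(ord1 j) eqxx mulr1n.
  by rewrite (_ : lshift n (@ord0 0) = @ord0 n) //; exact: val_inj.
rewrite row_mxEr !mxE (_ : rshift 1 j = lift (@ord0 n) j); last exact: val_inj.
by rewrite tnthS; congr (tnth _ _); exact: val_inj.
Qed.

Lemma row_measurable_prod n (A : set 'rV[R]_(1 + n)) : row_measurable A ->
  measurable [set p : mR * n.-tuple mR | A (row_mx p.1%:M (\row_i tnth p.2 i))].
Proof.
move=> mA; have := @measurable_tuple_cons R n measurableT _ mA; rewrite setTI; congr (measurable _).
by apply/funext => -[x t] /=; rewrite row_cons.
Qed.

(** Fubini in the order of the definition of [lebesgue_tuple]; the other order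
    below requires the uniqueness of product measures. *)
Lemma vol_integral_fst n (A : set 'rV[R]_(1 + n)) : vol A =
  (\int[lebesgue_measure]_x vol [set y | A (row_mx (x : R)%:M y)])%E.
Proof.
rewrite {1}/vol /= /pushforward /product_measure1; apply: eq_integral => x _ /=.
congr (lebesgue_tuple _); apply/seteqP; split => t; rewrite /xsection /= inE /=;
  by rewrite -[tuple _]/(tuple_cons (x, t)) row_cons.
Qed.

Lemma vol_integral_snd n (A : set 'rV[R]_(1 + n)) : row_measurable A ->
  vol A = (\int[lebesgue_tuple (n := n)]_t
    lebesgue_measure [set x : mR | A (row_mx (x : R)%:M (\row_i tnth t i))])%E.
Proof.
move=> /row_measurable_prod mA.
have [mu [muE _]] := lebesgue_tuple_measure R n.
rewrite /vol /= muE /pushforward.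
rewrite (_ : _ @^-1` _ =
  [set p : mR * n.-tuple mR | A (row_mx p.1%:M (\row_i tnth p.2 i))]); last first.
  by apply/seteqP; split=> -[x t] /=; rewrite -[tuple _]/(tuple_cons (x, t)) row_cons.
rewrite (@product_measure_unique _ _ _ _ _ lebesgue_measure mu
  [the {measure set _ -> \bar R} of (lebesgue_measure \x^ mu)%E]) //=.
  rewrite /product_measure2; apply: eq_integral => t _ /=; congr lebesgue_measure.
  by apply/seteqP; split => x; rewrite /ysection /= inE.
by move=> B C mB mC; rewrite product_measure2E.
Qed.
End Scaling.

(** * Volume under affine maps *)

Section LinearScaling.
Variable R : realType.
Local Notation mR := (measurableTypeR R).

(** Stated with preimages, which need no inverse map and commute with sections;
    the constant is therefore the inverse of the usual Jacobian. *)
Definition scales_vol n (c : R) (T : 'rV[R]_n -> 'rV[R]_n) :=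
  forall A, row_measurable A ->
    row_measurable (T @^-1` A) /\ vol (T @^-1` A) = (c%:E * vol A)%E.

Lemma scales_vol_comp n c1 c2 (T1 T2 : 'rV[R]_n -> 'rV[R]_n) :
  scales_vol c1 T1 -> scales_vol c2 T2 -> scales_vol (c1 * c2) (T2 \o T1).
Proof.
move=> h1 h2 A mA; have [m2 v2] := h2 _ mA; have [m1 v1] := h1 _ m2.
by rewrite comp_preimage; split; rewrite // v1 v2 muleA EFinM.
Qed.

Lemma row_measurable_section_fst n (A : set 'rV[R]_(1 + n)) (x : R) :
  row_measurable A -> row_measurable [set y | A (row_mx x%:M y)].
Proof.
move=> /row_measurable_prod /(measurable_xsection x); rewrite /row_measurable.
by congr (measurable _); apply/seteqP; split=> t; rewrite /xsection /= inE.
Qed.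

Lemma measurable_section_snd n (A : set 'rV[R]_(1 + n)) (t : n.-tuple mR) :
  row_measurable A ->
  measurable [set x : mR | A (row_mx (x : R)%:M (\row_i tnth t i))].
Proof.
move=> /row_measurable_prod /(measurable_ysection t).
by congr (measurable _); apply/seteqP; split=> x; rewrite /ysection /= inE.
Qed.

(** A block upper triangular map acts on each section with fixed first
    coordinate as a translate of its lower right block. *)
Lemma scales_vol_fst n c (w b : 'rV[R]_n) (N : 'M[R]_n) : 0 <= c ->
  (forall b', scales_vol c (fun y => y *m N + b')) ->
  scales_vol c (fun z : 'rV_(1 + n) =>
    z *m block_mx 1%:M w 0 N + row_mx 0 b).
Proof.
move=> c0 hN A mA; split; first exact: row_measurable_affine.
rewrite !vol_integral_fst -ge0_integralZl //=; last 2 first.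
- have [mu [muE _]] := lebesgue_tuple_measure R n.
  have := measurable_fun_xsection mu (row_measurable_prod mA).
  congr (measurable_fun _ _); apply/funext => x /=; rewrite /vol muE.
  by congr (mu _); apply/seteqP; split=> t; rewrite /xsection /= inE.
- move=> x _; have [mu [muE _]] := lebesgue_tuple_measure R n.
  by rewrite /vol muE.
apply: eq_integral => x _.
have [_ <-] := hN (x *: w + b) _ (row_measurable_section_fst x mA).
congr vol; apply/seteqP; split=> y /=;
  by rewrite mul_row_block mulmx1 mulmx0 addr0 add_row_mx addr0 mul_scalar_mx
    [_ *: w + y *m N]addrC -addrA.
Qed.

(** On the sections with the other coordinates fixed, such a map is an affine
    map of the line. *)
Lemma scales_vol_snd n (a b : R) (v : 'cV[R]_n) : a != 0 ->
  scales_vol `|a|^-1 (fun z : 'rV_(1 + n) =>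
    z *m block_mx a%:M 0 v 1%:M + row_mx b%:M 0).
Proof.
move=> a0 A mA; split; first exact: row_measurable_affine.
rewrite !vol_integral_snd //; last exact: row_measurable_affine.
have [mu [muE _]] := lebesgue_tuple_measure R n; rewrite muE.
rewrite -ge0_integralZl //=; last first.
  have := measurable_fun_ysection (@lebesgue_measure R) (row_measurable_prod mA).
  congr (measurable_fun _ _); apply/funext => t /=.
  by congr lebesgue_measure; apply/seteqP; split=> x; rewrite /ysection /= inE.
apply: eq_integral => t _.
set y := \row_i tnth t i.
rewrite -(lebesgue_measure_affine ((y *m v) 0 0 + b) a0 (measurable_section_snd t mA)).
have yvE : y *m v = ((y *m v) 0 0)%:M by exact: mx11_scalar.
congr lebesgue_measure; apply/seteqP; split=> x /=;
  rewrite mul_row_block mulmx0 mulmx1 add0r add_row_mx addr0;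
  by rewrite [X in _ + X + _]yvE -scalar_mxM -!raddfD /= (mulrC a) addrA.
Qed.

(** Every invertible block matrix is a product of three factors of the two
    shapes above, once a row operation has made its upper left entry nonzero;
    the remaining block is handled by induction on the dimension. *)
Lemma scales_vol_affine n (M : 'M[R]_n) (b : 'rV_n) : M \in unitmx ->
  scales_vol `|\det M|^-1 (fun x => x *m M + b).
Proof.
elim: n => [|n IHn] in M b *.
  move=> _; rewrite det_mx00 normr1 invr1.
  rewrite (_ : (fun _ => _) = id); first by move=> A mA; rewrite preimage_id mul1e.
  by apply/funext => x; rewrite [RHS]thinmx0 [LHS]thinmx0.
rewrite -[n.+1]/(1 + n)%N in M b * => uM.
have dM : \det M != 0 by rewrite -unitfE -unitmxE.
pose m : R := ulsubmx M 0 0; pose w := ursubmx M; pose v := dlsubmx M; pose N := drsubmx M.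
have ME : M = block_mx m%:M w v N.
  by rewrite -[LHS]submxK; congr block_mx; exact: mx11_scalar.
(* adding the combination e of the lower rows to the first row creates a
   nonzero pivot *)
have [e ae] : exists e : 'rV_n, m + (e *m v) 0 0 != 0.
  have [m0|m0] := eqVneq m 0; last by exists 0; rewrite mul0mx mxE addr0.
  have [v0|v0] := eqVneq v 0.
    by move: dM; rewrite ME m0 v0 det_ublock det_scalar1 mul0r eqxx.
  have [i vi] : exists i, v i 0 != 0.
    apply/existsP; apply: contraR v0; rewrite negb_exists => /forallP v0.
    apply/eqP/matrixP => i j; apply/eqP; rewrite (ord1 j) [eqbRHS]mxE.
    by have := v0 i; rewrite negbK.
  by exists (delta_mx 0 i); rewrite m0 add0r -rowE mxE.
set a := m + _ in ae.
pose w' := a^-1 *: (w + e *m N).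
pose N' := N - v *m w'.
have MF : M = block_mx 1%:M (- e) 0 1%:M *m block_mx a%:M 0 v 1%:M *m
              block_mx 1%:M w' 0 N'.
  rewrite !mulmx_block !mulmx0 !mul0mx !mulmx1 !mul1mx !addr0 !add0r ME.
  rewrite mul_scalar_mx -!scalemxAr.
  have evE : e *m v = (a - m)%:M by rewrite /a addrAC subrr add0r; exact: mx11_scalar.
  congr block_mx.
  - by rewrite mulNmx evE -raddfB /= subKr.
  - rewrite !mulNmx evE -raddfB /= subKr mul_scalar_mx scalerA.
    rewrite /N' mulmxBr mulmxA evE mul_scalar_mx opprB addrA -/w' /w' scalerA -scalerDl.
    rewrite -[X in _ *: _ - X]addr0 -[w in LHS](addrK (e *m N)).
    by congr (_ - _); rewrite ?addr0 // -[LHS]scale1r; congr (_ *: _); field.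
  - by rewrite scale1r scalemxAr /N' addrC subrK.
have detM : \det M = a * \det N'.
  by rewrite MF !det_mulmx !det_ublock det_lblock !det1 det_scalar1 !mul1r mulr1.
have uN' : N' \in unitmx.
  by rewrite unitmxE unitfE; move: dM; rewrite detM mulf_eq0 => /norP[].
pose b0 : R := lsubmx b 0 0; pose b1 := rsubmx b.
have bE : b = row_mx b0%:M b1.
  by rewrite -[LHS]hsubmxK; congr row_mx; exact: mx11_scalar.
have tr b' : scales_vol 1 (fun y : 'rV[R]_n => y *m 1%:M + b').
  by have := IHn 1%:M b' (unitmx1 _ _); rewrite det1 normr1 invr1.
have h1 := scales_vol_fst (- e) 0 ler01 tr.
have h2 := scales_vol_snd b0 v ae.
have h3 := @scales_vol_fst _ _ w' (b1 - b0 *: w') N' _ (fun b' => IHn N' b' uN').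
have := scales_vol_comp (scales_vol_comp h1 h2) (h3 _).
rewrite mul1r -invfM -normrM -detM => /(_ _); rewrite invr_ge0 normr_ge0 => /(_ isT).
congr scales_vol; apply/funext => x /=.
rewrite row_mx0 addr0 mulmxDl MF bE !mulmxA -addrA; congr (_ + _).
by rewrite mul_row_block mulmx1 !mulmx0 mul0mx !addr0 mul_scalar_mx add_row_mx addr0
  addrC subrK.
Qed.
End LinearScaling.

(** * Null sets and finite unions *)

Section VolumeTools.
Variable R : realType.
Local Notation mR := (measurableTypeR R).

Lemma vol_measure n : exists mu : {measure set (n.-tuple mR) -> \bar R},
  forall A : set 'rV[R]_n,
    vol A = mu [set t : n.-tuple mR | A (\row_i tnth t i)].
Proof.
by have [mu [muE _]] := lebesgue_tuple_measure R n; exists mu => A; rewrite /vol muE.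
Qed.

Section Tools.
Variable n : nat.
Implicit Types A B : set 'rV[R]_n.

Lemma vol_ge0 A : (0 <= vol A)%E.
Proof. by have [mu ->] := vol_measure n. Qed.

Lemma row_measurable0 : row_measurable (set0 : set 'rV[R]_n).
Proof. exact: measurable0. Qed.

Lemma vol0 : vol (set0 : set 'rV[R]_n) = 0%E.
Proof. by have [mu ->] := vol_measure n; rewrite measure0. Qed.

Lemma row_measurableU A B :
  row_measurable A -> row_measurable B -> row_measurable (A `|` B).
Proof. exact: measurableU. Qed.

Lemma row_measurableI A B :
  row_measurable A -> row_measurable B -> row_measurable (A `&` B).
Proof. exact: measurableI. Qed.

Lemma row_measurable_forall (I : finType) (F : I -> set 'rV[R]_n) :
  (forall i, row_measurable (F i)) -> row_measurable [set x | forall i, F i x].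
Proof. exact: measurable_forall. Qed.

Lemma le_vol A B : row_measurable A -> row_measurable B -> A `<=` B ->
  (vol A <= vol B)%E.
Proof.
have [mu muE] := vol_measure n; rewrite !muE => mA mB AB.
by apply: le_measure; rewrite ?inE // => t /=; exact: AB.
Qed.

(** Pieces of a polytope overlap along their faces, so additivity is needed up
    to an explicit null set. *)
Lemma volU_null A B N : row_measurable A -> row_measurable B ->
  row_measurable N -> A `&` B `<=` N -> vol N = 0%E ->
  vol (A `|` B) = (vol A + vol B)%E.
Proof.
move=> mA mB mN ABN N0.
have AB0 : vol (A `&` B) = 0%E.
  by apply/eqP; rewrite eq_le vol_ge0 -N0 le_vol //; exact: row_measurableI.
have [mu muE] := vol_measure n; move: AB0; rewrite !muE => AB0.
rewrite (measureDI mu mA mB) (measureDI mu (row_measurableU mA mB) mB).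
rewrite [X in (_ = _ + X + _)%E]AB0 adde0; congr (mu _ + mu _)%E;
  apply/seteqP; split=> t /=; tauto.
Qed.

Lemma vol_null_bigcup (F : nat -> set 'rV[R]_n) :
  (forall k, row_measurable (F k)) -> (forall k, vol (F k) = 0%E) ->
  forall A, row_measurable A -> A `<=` \bigcup_k F k -> vol A = 0%E.
Proof.
move=> mF F0 A mA AF; have [mu muE] := vol_measure n; rewrite muE.
have N k : mu.-negligible [set t : n.-tuple mR | F k (\row_i tnth t i)].
  apply/negligibleP; first exact: mF.
  by have := F0 k; rewrite muE.
apply/negligibleP; first exact: mA.
apply: negligibleS (negligible_bigcup N).
by move=> t /= /AF[k _ Fk]; exists k.
Qed.

Lemma row_measurable_bigU (I : eqType) (r : seq I) (F : I -> set 'rV[R]_n) :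
  (forall i, i \in r -> row_measurable (F i)) ->
  row_measurable [set x | exists2 i, i \in r & F i x].
Proof.
elim: r => [|i r IHr] mF.
  by rewrite (_ : mkset _ = set0) -?subset0; [exact: row_measurable0|move=> x []].
rewrite (_ : mkset _ = F i `|` [set x | exists2 j, j \in r & F j x]).
  apply: row_measurableU; first by apply: mF; rewrite mem_head.
  by apply: IHr => j jr; apply: mF; rewrite in_cons jr orbT.
apply/seteqP; split=> x /=.
  by move=> [j]; rewrite in_cons => /orP[/eqP->|jr] Fx; [left|right; exists j].
by move=> [Fx|[j jr Fx]]; [exists i; rewrite ?mem_head|exists j; rewrite // in_cons jr orbT].
Qed.

Lemma vol_bigU_null (I : eqType) (r : seq I) (F : I -> set 'rV[R]_n)
    (N : I -> I -> set 'rV[R]_n) : uniq r ->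
  (forall i, i \in r -> row_measurable (F i)) ->
  (forall i j, i \in r -> j \in r -> i != j ->
    [/\ row_measurable (N i j), F i `&` F j `<=` N i j & vol (N i j) = 0%E]) ->
  vol [set x | exists2 i, i \in r & F i x] = (\sum_(i <- r) vol (F i))%E.
Proof.
elim: r => [|i r IHr] /=.
  by move=> *; rewrite big_nil (_ : mkset _ = set0) ?vol0 // -subset0 => x [].
move=> /andP[ir ur] mF NP; rewrite big_cons -IHr //; last 2 first.
- by move=> j jr; apply: mF; rewrite in_cons jr orbT.
- by move=> j k jr kr; apply: NP; rewrite in_cons ?jr ?kr orbT.
have mFr j : j \in r -> row_measurable (F j).
  by move=> jr; apply: mF; rewrite in_cons jr orbT.
have NPr j : j \in r ->
    [/\ row_measurable (N i j), F i `&` F j `<=` N i j & vol (N i j) = 0%E].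
  move=> jr; apply: NP; rewrite ?mem_head // ?in_cons ?jr ?orbT //.
  by apply: contraNneq ir => ->.
have mFi : row_measurable (F i) by apply: mF; rewrite mem_head.
rewrite (_ : mkset _ = F i `|` [set x | exists2 j, j \in r & F j x]); last first.
  apply/seteqP; split=> x /=.
    by move=> [j]; rewrite in_cons => /orP[/eqP->|jr] Fx; [left|right; exists j].
  by move=> [Fx|[j jr Fx]]; [exists i; rewrite ?mem_head|exists j; rewrite // in_cons jr orbT].
pose M := [set x | exists2 j, j \in r & N i j x].
have mM : row_measurable M by apply: row_measurable_bigU => j /NPr[].
apply: (volU_null mFi _ mM); first exact: row_measurable_bigU.
  by move=> x [Fi [j jr Fj]]; exists j => //; have [_ + _] := NPr j jr; exact.
apply: (@vol_null_bigcup (fun k => if k < size r then N i (nth i r k) else set0)%N) => //.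
- by move=> k; case: ifP => [kr|_]; [case: (NPr _ (mem_nth i kr))|exact: row_measurable0].
- by move=> k; case: ifP => [kr|_]; [case: (NPr _ (mem_nth i kr))|exact: vol0].
- move=> x [j jr Nx]; exists (index j r) => //=; by rewrite index_mem jr nth_index.
Qed.

Definition row_box (r : R) : set 'rV[R]_n := [set x | forall i, `|x 0 i| <= r].

Lemma row_boxE r : [set t : n.-tuple mR | row_box r (\row_i tnth t i)] = tuple_box r.
Proof.
by apply/seteqP; split=> t /= h i; have := h i; rewrite /= in_itv /= mxE ler_norml.
Qed.

Lemma row_measurable_box r : row_measurable (row_box r).
Proof. by rewrite /row_measurable row_boxE; exact: measurable_tuple_box. Qed.

Lemma vol_box_fin r : (vol (row_box r) < +oo)%E.
Proof.
have [mu [muE mufin]] := lebesgue_tuple_measure R n.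
by rewrite /vol row_boxE muE.
Qed.

Lemma row_box_cover (x : 'rV[R]_n) : exists k : nat, row_box k%:R x.
Proof.
exists (Num.bound (\sum_i `|x 0 i|)) => i.
apply: (@le_trans _ _ (\sum_i `|x 0 i|)).
  by rewrite (bigD1 i) //= lerDl sumr_ge0.
by apply/ltW/archi_boundP/sumr_ge0.
Qed.
End Tools.

Lemma vol_setT_gt0 n : (0 < vol [set: 'rV[R]_n])%E.
Proof.
elim: n => [|n IHn].
  by rewrite /vol /= diracE mem_set //.
rewrite -[n.+1]/(1 + n)%N vol_integral_fst.
rewrite (_ : (fun x => _) = cst (vol [set: 'rV[R]_n])) //.
rewrite (integral_cst lebesgue_measure) // mule_gt0 //.
have := @lebesgue_measure_itv R `]-oo, +oo[; rewrite set_itvNyy /= => ->.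
by rewrite ltry.
Qed.

(** Both factorizations of the same block matrix
    into triangular blocks have the same determinant. *)
Lemma det_rank1 n (f w : 'rV[R]_n) : \det (1%:M + f^T *m w) = 1 + dot f w.
Proof.
pose B := block_mx (1%:M : 'M[R]_1) (- w) f^T (1%:M : 'M[R]_n).
have B1 : B = block_mx 1%:M 0 f^T 1%:M *m block_mx 1%:M (- w) 0 (1%:M + f^T *m w).
  rewrite mulmx_block !mulmx1 !mul1mx !mulmx0 !mul0mx !addr0 mulmxN addrC.
  by rewrite addrK.
have B2 : B = block_mx (1%:M + w *m f^T) (- w) 0 1%:M *m block_mx 1%:M 0 f^T 1%:M.
  by rewrite mulmx_block !mulmx1 !mul1mx !mulmx0 !add0r mulNmx addrK.
have := congr1 determinant B1.
rewrite B2 !det_mulmx !det_ublock !det_lblock !det1 !mul1r !mulr1 => <-.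
rewrite det_mx11 !mxE eqxx; congr (_ + _); apply: eq_bigr => i _.
by rewrite !mxE mulrC.
Qed.

Lemma dotDr n (f x y : 'rV[R]_n) : dot f (x + y) = dot f x + dot f y.
Proof. by rewrite /dot -big_split; apply: eq_bigr => i _; rewrite mxE mulrDr. Qed.

Lemma dotZr n (f x : 'rV[R]_n) a : dot f (a *: x) = a * dot f x.
Proof. by rewrite /dot mulr_sumr; apply: eq_bigr => i _; rewrite mxE mulrCA. Qed.

Lemma dotC n (x y : 'rV[R]_n) : dot x y = dot y x.
Proof. by apply: eq_bigr => i _; rewrite mulrC. Qed.

Lemma dotNr n (f x : 'rV[R]_n) : dot f (- x) = - dot f x.
Proof. by rewrite -scaleN1r dotZr mulN1r. Qed.

Lemma dotBr n (f x y : 'rV[R]_n) : dot f (x - y) = dot f x - dot f y.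
Proof. by rewrite dotDr dotNr. Qed.

Lemma dot0r n (f : 'rV[R]_n) : dot f 0 = 0.
Proof. by rewrite -(scale0r 0) dotZr mul0r. Qed.

Lemma dot_sumr n (f : 'rV[R]_n) (I : finType) (P : pred I) (x : I -> 'rV[R]_n) :
  dot f (\sum_(i | P i) x i) = \sum_(i | P i) dot f (x i).
Proof. by apply: (big_morph (dot f) (dotDr f) (dot0r f)). Qed.

Lemma dotDl n (f g x : 'rV[R]_n) : dot (f + g) x = dot f x + dot g x.
Proof. by rewrite !(dotC _ x) dotDr. Qed.

Lemma dotZl n (f x : 'rV[R]_n) a : dot (a *: f) x = a * dot f x.
Proof. by rewrite !(dotC _ x) dotZr. Qed.

Lemma dotNl n (f x : 'rV[R]_n) : dot (- f) x = - dot f x.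
Proof. by rewrite !(dotC _ x) dotNr. Qed.

Lemma dotBl n (f g x : 'rV[R]_n) : dot (f - g) x = dot f x - dot g x.
Proof. by rewrite dotDl dotNl. Qed.

Lemma mul_tr_row_dot n (x f : 'rV[R]_n) (w : 'rV[R]_n) :
  x *m (f^T *m w) = dot f x *: w.
Proof.
rewrite mulmxA [x *m f^T]mx11_scalar mul_scalar_mx; congr (_ *: _).
by rewrite !mxE; apply: eq_bigr => i _; rewrite !mxE mulrC.
Qed.

Lemma scales_vol_rank1 n (f w : 'rV[R]_n) (c : R) : 1 + dot f w != 0 ->
  scales_vol `|1 + dot f w|^-1 (fun x => x + (dot f x + c) *: w).
Proof.
move=> d0; have := @scales_vol_affine R n (1%:M + f^T *m w) (c *: w).
rewrite unitmxE det_rank1 unitfE => /(_ d0); congr scales_vol.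
apply/funext => x; rewrite mulmxDr mulmx1 mul_tr_row_dot scalerDl addrA //.
Qed.

Lemma row_measurable_ge0 n (f : 'rV[R]_n) c : row_measurable [set x | 0 <= dot f x + c].
Proof.
rewrite (_ : mkset _ = [set x | - c <= dot f x]); first exact: row_measurable_halfspace.
by apply/seteqP; split=> x /= h; lra.
Qed.

Lemma row_measurable_eq0 n (f : 'rV[R]_n) c : row_measurable [set x | dot f x + c = 0].
Proof.
rewrite (_ : mkset _ = [set x | 0 <= dot f x + c] `&` [set x | 0 <= dot (- f) x - c]).
  by apply: row_measurableI; exact: row_measurable_ge0.
apply/seteqP; split=> x /=; rewrite dotNl; first by lra.
by move=> [h1 h2]; lra.
Qed.

(** A dilation with factor 2 transversally to the hyperplane fixes each of its
    points, so the volume v of a bounded part of it satisfies v = v / 2. *)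
Lemma vol_hyperplane0 n (f v : 'rV[R]_n) c : dot f v != 0 ->
  vol [set x | dot f x + c = 0] = 0%E.
Proof.
move=> fv; pose w := (dot f v)^-1 *: v.
have fw : dot f w = 1 by rewrite dotZr mulVf.
have d2 : 1 + dot f w != 0 by rewrite fw; lra.
pose H := [set x | dot f x + c = 0].
have mH : row_measurable H by exact: row_measurable_eq0.
have mHk (k : nat) := row_measurableI mH (@row_measurable_box n k%:R).
apply: (@vol_null_bigcup _ (fun k => H `&` @row_box n k%:R)) => // [k|]; last first.
  by move=> x Hx; have [k kx] := row_box_cover x; exists k.
have fin : (vol (H `&` @row_box n k%:R) < +oo)%E.
  apply: le_lt_trans (@vol_box_fin n k%:R); apply: le_vol => //.
  exact: row_measurable_box.
have [_] := scales_vol_rank1 c d2 (mHk k).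
rewrite (_ : _ @^-1` _ = H `&` @row_box n k%:R).
  have := vol_ge0 (H `&` @row_box n k%:R); move: fin.
  case: (vol _) => [r| |] //= _ r0 [].
  rewrite fw ger0_norm // (_ : (1 + 1)^-1 = 1 / 2); last by field.
  by move=> rE; congr EFin; lra.
apply/seteqP; split=> x /= [].
  rewrite /H /= dotDr dotZr fw mulr1 => Hx; have Hx0 : dot f x + c = 0 by lra.
  by rewrite Hx0 scale0r addr0.
by rewrite /H /= => Hx bx; rewrite Hx scale0r addr0.
Qed.
End VolumeTools.

(** * Affine functions *)

Section AffineFunctions.
Variables (R : realType) (n : nat).
Implicit Types p q : 'rV[R]_n -> R.

Definition affine_fun p := exists f c, forall x, p x = dot f x + c.

Lemma affine_cst a : affine_fun (fun=> a).
Proof. by exists 0, a => x; rewrite dotC dot0r add0r. Qed.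

Lemma affineD p q : affine_fun p -> affine_fun q -> affine_fun (fun x => p x + q x).
Proof.
move=> [f [c pE]] [g [d qE]]; exists (f + g), (c + d) => x.
by rewrite pE qE dotDl; ring.
Qed.

Lemma affineZ a p : affine_fun p -> affine_fun (fun x => a * p x).
Proof.
move=> [f [c pE]]; exists (a *: f), (a * c) => x.
by rewrite pE dotZl; ring.
Qed.

Lemma affine_sum (I : Type) (r : seq I) (p : I -> 'rV[R]_n -> R) :
  (forall i, affine_fun (p i)) -> affine_fun (fun x => \sum_(i <- r) p i x).
Proof.
move=> ap; elim: r => [|i r IHr].
  rewrite (_ : (fun x => _) = fun=> 0); first exact: affine_cst.
  by apply/funext => x; rewrite big_nil.
rewrite (_ : (fun x => _) = fun x => p i x + \sum_(j <- r) p j x).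
  exact: affineD.
by apply/funext => x; rewrite big_cons.
Qed.

Lemma affineB p q : affine_fun p -> affine_fun q -> affine_fun (fun x => p x - q x).
Proof.
move=> ap aq; rewrite (_ : (fun x => _) = fun x => p x + -1 * q x).
  by apply: affineD => //; exact: affineZ.
by apply/funext => x; rewrite mulN1r.
Qed.

Lemma affine_translate p x t v : affine_fun p ->
  p (x + t *: v) = p x + t * (p v - p 0).
Proof. by move=> [f [c pE]]; rewrite !pE dotDr dotZr dot0r; ring. Qed.

Lemma row_measurable_affine_ge0 p : affine_fun p -> row_measurable [set x | 0 <= p x].
Proof.
move=> [f [c pE]]; have := row_measurable_ge0 f c.
by congr row_measurable; apply/seteqP; split=> x /=; rewrite pE.
Qed.

Lemma row_measurable_affine_le p q : affine_fun p -> affine_fun q ->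
  row_measurable [set x | p x <= q x].
Proof.
move=> ap aq; have := row_measurable_affine_ge0 (affineB aq ap).
by congr row_measurable; apply/seteqP; split=> x /=; rewrite subr_ge0.
Qed.

Lemma row_measurable_affine_eq0 p : affine_fun p -> row_measurable [set x | p x = 0].
Proof.
move=> [f [c pE]]; have := row_measurable_eq0 f c.
by congr row_measurable; apply/seteqP; split=> x /=; rewrite pE.
Qed.

Lemma vol_affine_eq0 p x y : affine_fun p -> p x != p y ->
  vol [set z | p z = 0] = 0%E.
Proof.
move=> [f [c pE]] pxy; rewrite -[RHS](@vol_hyperplane0 R n f (x - y) c).
  by congr vol; apply/seteqP; split=> z /=; rewrite pE.
apply: contra pxy => /eqP; rewrite dotBr => fxy.
by rewrite !pE; apply/eqP; lra.
Qed.

(** With f the gradient of p, the linear part of the map is 1 + f^T w and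
    [p w - p 0] is the scalar product of f and w. *)
Lemma scales_vol_transvection p w : affine_fun p -> 1 + (p w - p 0) != 0 ->
  scales_vol `|1 + (p w - p 0)|^-1 (fun x => x + p x *: w).
Proof.
move=> [f [c pE]]; rewrite !pE dot0r add0r addrK => d0.
rewrite (_ : (fun x => _) = (fun x => x + (dot f x + c) *: w)).
  exact: scales_vol_rank1.
by apply/funext => x; rewrite pE.
Qed.
End AffineFunctions.

(** * The volume of a prism over a facet *)

Section Barycentric.
Variables (R : realType) (n : nat).
Variables (s : 'I_n.+1 -> 'rV[R]_n) (beta : 'I_n.+1 -> 'rV[R]_n -> R).

(** Working with the barycentric coordinates rather than with the vertices turns
    every polytope below into a finite set of affine inequalities. *)
Record barycentric : Prop := Barycentric {
  bary_affine : forall j, affine_fun (beta j);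
  bary_vertex : forall j k, beta j (s k) = (j == k)%:R;
  bary_sum : forall x, \sum_j beta j x = 1;
  bary_point : forall x, \sum_j beta j x *: s j = x
}.

Hypothesis hb : barycentric.

Definition bary_simplex : set 'rV[R]_n := [set x | forall j, 0 <= beta j x].
Local Notation S := bary_simplex.

Lemma row_measurable_bary_simplex : row_measurable S.
Proof.
apply: row_measurable_forall => j; apply: row_measurable_affine_ge0; exact: (bary_affine hb j).
Qed.

Lemma bary_le1 x j : S x -> beta j x <= 1.
Proof.
move=> Sx; rewrite -(bary_sum hb x) (bigD1 j) //= lerDl.
by apply: sumr_ge0 => k _; exact: Sx.
Qed.

Lemma vol_bary_simplex_fin : (vol S < +oo)%E.
Proof.
pose r : R := \sum_j \sum_i `|s j 0 i|.
apply: le_lt_trans (@vol_box_fin R n r); apply: le_vol.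
- exact: row_measurable_bary_simplex.
- exact: row_measurable_box.
move=> x Sx i; rewrite -(bary_point hb x) summxE.
apply: (le_trans (ler_norm_sum _ _ _)). apply: ler_sum => j _.
rewrite mxE normrM (ger0_norm (Sx j)).
apply: (@le_trans _ _ `|s j 0 i|); first by rewrite ler_piMl // bary_le1.
by rewrite (bigD1 i) //= lerDl sumr_ge0.
Qed.

(** The dilates of a simplex about its centroid cover the space, and each of them
    would be null if the simplex were. *)
Lemma vol_bary_simplex_gt0 : (0 < vol S)%E.
Proof.
rewrite lt0e vol_ge0 andbT; apply/eqP => S0.
pose N : R := n.+1%:R; have N0 : 0 < N by rewrite ltr0n.
pose g : 'rV[R]_n := N^-1 *: \sum_k s k.
have bg j : beta j g = N^-1.
  have [f [c bE]] := bary_affine hb j.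
  have fs k : dot f (s k) = (j == k)%:R - c by rewrite -(bary_vertex hb) bE addrK.
  rewrite bE dotZr dot_sumr (eq_bigr _ (fun k _ => fs k)) big_split /=.
  rewrite sumr_const card_ord (bigD1 j) //= eqxx big1 ?addr0 => [|k /negPf].
    by rewrite mulr1n -mulr_natr -/N; clear S0; field; lra.
  by rewrite eq_sym => ->.
pose T (k : nat) (x : 'rV[R]_n) := x *m (k.+1%:R^-1)%:M + (1 - k.+1%:R^-1) *: g.
have hT k : scales_vol `|\det ((k.+1%:R^-1)%:M : 'M[R]_n)|^-1 (T k).
  apply: scales_vol_affine; rewrite unitmxE det_scalar unitfE.
  by rewrite expf_neq0 // invr_neq0 // pnatr_eq0.
have : vol [set: 'rV[R]_n] = 0%E.
  apply: (@vol_null_bigcup _ _ (fun k => T k @^-1` S)).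
  - by move=> k; case: (hT k _ row_measurable_bary_simplex).
  - by move=> k; case: (hT k _ row_measurable_bary_simplex) => _ ->; rewrite S0 mule0.
  - exact: measurableT.
  - move=> x _; pose M := N * \sum_j `|beta j x|.
    have M0 : 0 <= M by rewrite mulr_ge0 ?sumr_ge0 // ltW.
    exists (Num.bound M) => // j.
    have kM : M < (Num.bound M)%:R := archi_boundP M0.
    have [f [c bE]] := bary_affine hb j.
    have := bg j; rewrite bE => gE.
    have xM : - (beta j x) <= \sum_j `|beta j x|.
      rewrite (bigD1 j) //=; apply: (le_trans (ler_norm _)).
      by rewrite normrN lerDl sumr_ge0.
    rewrite bE /T mul_mx_scalar dotDr (dotZr f x) (dotZr f g).
    set k : R := _%:R in kM *.
    have -> : (Num.bound M).+1%:R = k + 1 :> R by rewrite -natr1.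
    have k0 : 0 < k + 1 by rewrite ltr_wpDl // ltW // (le_lt_trans M0).
    rewrite (_ : _ + _ + _ = (beta j x + k / N) / (k + 1)).
      rewrite divr_ge0 //; last exact: ltW.
      rewrite -lerBlDl sub0r; apply: (le_trans xM).
      by rewrite ler_pdivlMr // mulrC ltW.
    by clear S0; rewrite bE (_ : dot f g = N^-1 - c); [field; lra|by rewrite -gE addrK].
by have := vol_setT_gt0 R n; rewrite lt0e => /andP[/eqP].
Qed.

Section Direction.
Variable u : 'rV[R]_n.

(** The derivative of the barycentric coordinate j in the direction u. *)
Definition bary_dir j := beta j u - beta j 0.
Local Notation b := bary_dir.

Lemma bary_dir_sum : \sum_j b j = 0.
Proof. by rewrite /bary_dir sumrB !(bary_sum hb) subrr. Qed.

Lemma bary_dir_point : \sum_j b j *: s j = u.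
Proof.
rewrite /bary_dir; under eq_bigr do rewrite scalerBl.
by rewrite sumrB !(bary_point hb) subr0.
Qed.

Variable i : 'I_n.+1.
Hypothesis bi0 : b i < 0.
Local Notation B := (- b i).
Let B0 : 0 < B. Proof. by rewrite oppr_gt0. Qed.

(** [exit_time x] is the time at which the line through x in the direction u
    meets the hyperplane of the facet opposite to [s i], and [exit_coord] gives
    the barycentric coordinates of the meeting point. *)
Definition exit_time x := beta i x / B.
Definition exit_coord j x := beta j x + exit_time x * b j.
Local Notation tau := exit_time.
Local Notation y := exit_coord.

Lemma affine_exit_time : affine_fun tau.
Proof.
rewrite (_ : tau = fun x => B^-1 * beta i x); first exact: affineZ (bary_affine hb i).
by apply/funext => x; rewrite /tau mulrC.
Qed.

Lemma affine_exit_coord j : affine_fun (y j).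
Proof.
apply: affineD; first exact: (bary_affine hb j).
rewrite (_ : (fun x => _) = fun x => b j * tau x); first exact/affineZ/affine_exit_time.
by apply/funext => x; rewrite mulrC.
Qed.

Lemma exit_coord_i x : y i x = 0.
Proof. by rewrite /y /tau; field; rewrite -oppr_eq0 lt0r_neq0. Qed.

Lemma exit_time_dir : tau u - tau 0 = -1.
Proof. by rewrite /tau -mulrBl -/(b i); field; rewrite -oppr_eq0 lt0r_neq0. Qed.

Lemma exit_coord_dir j : y j u - y j 0 = 0.
Proof.
rewrite /y opprD addrACA -/(b j) -mulrBl exit_time_dir; ring.
Qed.

(** The affine interpolation of the numbers g j, at the meeting point. *)
Definition exit_interp (g : 'I_n.+1 -> R) x := \sum_j g j * y j x.
Local Notation G := exit_interp.

Let affine_G g : affine_fun (G g).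
Proof. by apply: affine_sum => j; exact: affineZ (affine_exit_coord _). Qed.

Let G_dir g : G g u - G g 0 = 0.
Proof.
rewrite /G -sumrB big1 // => j _; by rewrite -mulrBr exit_coord_dir mulr0.
Qed.

Definition prism (g : 'I_n.+1 -> R) : set 'rV[R]_n :=
  [set x | [/\ forall j, 0 <= y j x, 0 <= tau x & tau x <= G g x]].

Let slab g k a : set 'rV[R]_n :=
  [set x | [/\ forall j, 0 <= y j x, G g x <= tau x & tau x <= G g x + a * y k x]].

Let row_measurable_slab g k a : row_measurable (slab g k a).
Proof.
rewrite (_ : slab g k a = [set x | forall j, 0 <= y j x] `&`
  ([set x | G g x <= tau x] `&` [set x | tau x <= G g x + a * y k x])); last first.
  by apply/seteqP; split=> x /=; [case|case=> ? []].
apply: row_measurableI.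
  by apply: row_measurable_forall => j; exact: row_measurable_affine_ge0 (affine_exit_coord j).
apply: row_measurableI; apply: row_measurable_affine_le => //.
- exact: affine_exit_time.
- exact: affine_exit_time.
- by apply: affineD => //; exact: affineZ (affine_exit_coord _).
Qed.

Lemma row_measurable_prism g : row_measurable (prism g).
Proof.
rewrite (_ : prism g = [set x | forall j, 0 <= y j x] `&`
  ([set x | 0 <= tau x] `&` [set x | tau x <= G g x])); last first.
  by apply/seteqP; split=> x /=; [case|case=> ? []].
apply: row_measurableI.
  by apply: row_measurable_forall => j; exact: row_measurable_affine_ge0 (affine_exit_coord j).
apply: row_measurableI; first exact: row_measurable_affine_ge0 affine_exit_time.
by apply: row_measurable_affine_le => //; exact: affine_exit_time.
Qed.

Let null_top g : vol [set x | tau x - G g x = 0] = 0%E.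
Proof.
apply: (vol_affine_eq0 (x := u) (y := 0)).
  by apply: affineB => //; exact: affine_exit_time.
have := exit_time_dir; have := G_dir g => h1 h2.
by apply/eqP => h3; lra.
Qed.

Let row_measurable_top g : row_measurable [set x | tau x - G g x = 0].
Proof.
exact: row_measurable_affine_eq0 (affineB affine_exit_time (affine_G g)).
Qed.

(* The shear x + G(x) u moves the lower face of the slab onto the facet; then a
   map fixing that facet turns the result into the simplex. Both are of the form
   x + p(x) w with p affine, and only the second one changes volumes. *)
Let vol_slab g k a : k != i -> 0 <= a -> vol (slab g k a) = ((a * B)%:E * vol S)%E.
Proof.
move=> ki; rewrite le_eqVlt => /predU1P[<-|a0].
  rewrite mul0r mul0e; apply/eqP; rewrite eq_le vol_ge0 andbT -(null_top g).
  apply: le_vol => // x /= [_ h1 h2]; rewrite mul0r addr0 in h2.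
  by apply/eqP; rewrite subr_eq0 eq_le h1 h2.
pose w := u + a^-1 *: (s i - s k).
have tau_si : tau (s i) = B^-1 by rewrite /tau (bary_vertex hb) eqxx mul1r.
have tau_sk : tau (s k) = 0.
  by rewrite /tau (bary_vertex hb) eq_sym (negPf ki) mul0r.
have dirE p : affine_fun p -> p w - p 0 = (p u - p 0) + a^-1 * (p (s i) - p (s k)).
  move=> ap; have := affine_translate (s k) 1 (s i - s k) ap.
  rewrite scale1r mul1r addrC subrK => ->.
  by rewrite /w affine_translate //; ring.
clearbody w.
have tauw : 1 + (tau w - tau 0) = (a * B)^-1.
  rewrite (dirE _ affine_exit_time) exit_time_dir tau_si tau_sk.
  by rewrite addrA subrr add0r subr0 invfM.
have d1 : 1 + (G g u - G g 0) != 0 by rewrite G_dir addr0 oner_eq0.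
have d2 : 1 + (tau w - tau 0) != 0.
  by rewrite tauw invr_eq0 mulf_neq0 // lt0r_neq0.
have := scales_vol_comp (scales_vol_transvection (affine_G g) d1)
  (scales_vol_transvection affine_exit_time d2).
move=> /(_ S row_measurable_bary_simplex)[_].
rewrite G_dir addr0 normr1 invr1 mul1r tauw.
rewrite normfV invrK ger0_norm ?mulr_ge0 ?(ltW a0) ?(ltW B0) // => <-.
have TE x j : beta j ((x + G g x *: u) + tau (x + G g x *: u) *: w) =
    y j x + (tau x - G g x) / a * ((j == i)%:R - (j == k)%:R).
  rewrite !(affine_translate _ _ _ (bary_affine hb j)).
  rewrite (affine_translate _ _ _ affine_exit_time).
  rewrite (dirE _ (bary_affine hb j)) exit_time_dir !(bary_vertex hb) -/(b j) /y.
  by ring.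
congr vol; apply/seteqP; split=> x /=.
  move=> [y0 h1 h2] j /=; rewrite TE.
  have [->|ji] := eqVneq j i.
    rewrite exit_coord_i eq_sym (negPf ki) subr0 mulr1 add0r.
    by rewrite divr_ge0 ?subr_ge0 // ltW.
  have [->|jk] := eqVneq j k; last by rewrite subrr mulr0 addr0.
  by rewrite sub0r mulrN1 subr_ge0 ler_pdivrMr // mulrC lerBlDl.
move=> h; have hj j := h j; move: hj => /=; rewrite -/G => hj.
have s0 : 0 <= (tau x - G g x) / a.
  have := hj i; rewrite TE exit_coord_i eqxx eq_sym (negPf ki).
  by rewrite subr0 mulr1 add0r.
have yk : (tau x - G g x) / a <= y k x.
  have := hj k; rewrite TE eqxx (negPf ki).
  by rewrite sub0r mulrN1 subr_ge0.
split=> [j||].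
- have [->|jk] := eqVneq j k; first exact: le_trans yk.
  have := hj j; rewrite TE (negPf jk) subr0.
  by have [->|ji] := eqVneq j i; [rewrite exit_coord_i|rewrite mulr0 addr0].
- by move: s0; rewrite pmulr_lge0 ?invr_gt0 // subr_ge0.
- by move: yk; rewrite ler_pdivrMr // mulrC lerBlDl.
Qed.

Let prism_eq g g' : (forall x, G g x = G g' x) -> prism g = prism g'.
Proof.
by move=> gg; apply/seteqP; split=> x /= [h1 h2 h3]; split=> //; move: h3; rewrite gg.
Qed.

(** The heights g j are added one at a time: each adds a slab whose
    volume is a multiple of g j, and which meets the previous ones only in a hyperplane. *)
Lemma vol_prism g : (forall j, 0 <= g j) ->
  vol (prism g) = ((B * \sum_(j | j != i) g j)%:E * vol S)%E.
Proof.
move=> g0.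
suff H (r : seq 'I_n.+1) : uniq r -> i \notin r ->
    vol (prism (fun j => if j \in r then g j else 0)) =
    ((B * \sum_(j <- r) g j)%:E * vol S)%E.
  have := H [seq j <- index_enum 'I_n.+1 | j != i].
  rewrite filter_uniq ?index_enum_uniq // mem_filter /= eqxx /= => /(_ isT isT).
  rewrite big_filter => <-; congr vol; apply: prism_eq => x; apply: eq_bigr => j _.
  rewrite mem_filter mem_index_enum andbT.
  by have [->|] := eqVneq j i; rewrite ?exit_coord_i ?mulr0.
elim: r => [_ _|k r IHr].
  rewrite big_nil mulr0 mul0e; apply/eqP; rewrite eq_le vol_ge0 andbT.
  rewrite -(null_top (fun=> 0)); apply: le_vol => //; first exact: row_measurable_prism.
  by move=> x [_ h1 h2]; apply/eqP; rewrite subr_eq0 eq_le h2 /G big1 // => j _; rewrite mul0r.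
rewrite [uniq _]/= => /andP[kr ur]; rewrite in_cons negb_or => /andP[ik ir].
set gr := fun j => if j \in r then g j else 0 in IHr.
have Gk x : G (fun j => if j \in k :: r then g j else 0) x = G gr x + g k * y k x.
  rewrite /G (bigD1 k) //= mem_head [in RHS](bigD1 k) //= /gr (negPf kr) mul0r add0r addrC.
  by congr (_ + _); apply: eq_bigr => j /negPf jk; rewrite in_cons jk.
have gr0 j : 0 <= gr j by rewrite /gr; case: ifP.
have Ggr0 x : (forall j, 0 <= y j x) -> 0 <= G gr x.
  by move=> y0; apply: sumr_ge0 => j _; rewrite mulr_ge0.
rewrite (_ : prism _ = prism gr `|` slab gr k (g k)); last first.
  apply/seteqP; split=> x /=; rewrite /prism /= Gk.
    move=> [y0 t0 tk]; have [tg|/ltW tg] := lerP (tau x) (G gr x); by [left|right].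
  move=> [[y0 t0 tg]|[y0 tg tk]]; split=> //.
    by rewrite (le_trans tg) // lerDl mulr_ge0.
  by rewrite (le_trans (Ggr0 x y0)).
rewrite (@volU_null _ _ _ _ [set x | tau x - G gr x = 0]) //; last 2 first.
- exact: row_measurable_prism.
- move=> x /= [[_ _ h1] [_ h2 _]]; apply/eqP; by rewrite subr_eq0 eq_le h1 h2.
rewrite IHr // vol_slab 1?eq_sym // -ge0_muleDl ?lee_fin //.
- by rewrite -EFinD big_cons; congr (_%:E * _)%E; ring.
- by rewrite mulr_ge0 ?(ltW B0) // sumr_ge0.
- by rewrite mulr_ge0 ?(ltW B0).
Qed.

End Direction.
End Barycentric.

(** * The convex hull of a simplex and its mirror image *)

Section ConvexHulls.
Variables (R : realType) (n : nat).
Implicit Types A : set 'rV[R]_n.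

Lemma convex_setP A : @convex_set R 'rV[R]_n A <->
  forall x y p, A x -> A y -> 0 <= p <= 1 -> A (p *: x + (1 - p) *: y).
Proof.
split=> [cA x y p Ax Ay /andP[p0 p1]|cA x y l].
  have := cA x y (Itv01 p0 p1); rewrite !inE => /(_ Ax Ay).
  by [].
by rewrite !inE => Ax Ay; apply: cA => //; apply/andP; split.
Qed.

(** Normalizing by the total weight lets the induction run over a list of points
    whose weights do not add up to 1. *)
Lemma convex_sum A (I : eqType) (r : seq I) (x : I -> 'rV[R]_n) (l : I -> R) :
  @convex_set R 'rV[R]_n A -> (forall i, A (x i)) -> (forall i, 0 <= l i) ->
  0 < \sum_(i <- r) l i ->
  A ((\sum_(i <- r) l i)^-1 *: \sum_(i <- r) l i *: x i).
Proof.
move=> /convex_setP cA Ax l0; elim: r => [|k r IHr]; first by rewrite !big_nil ltxx.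
rewrite !big_cons; set L := \sum_(i <- r) l i in IHr *.
set X := \sum_(i <- r) _ in IHr *.
have : 0 <= L by exact: sumr_ge0.
rewrite le_eqVlt => /predU1P[L0|L0 lL0].
  have X0 : X = 0.
    rewrite /X big_seq big1 // => i ir; suff -> : l i = 0 by rewrite scale0r.
    apply/eqP; rewrite eq_le l0 andbT {1}L0 /L (perm_big _ (perm_to_rem ir)).
    by rewrite big_cons lerDl sumr_ge0.
  by rewrite -L0 X0 !addr0 => lk; rewrite scalerA mulVf ?lt0r_neq0 // scale1r.
have := cA (x k) (L^-1 *: X) (l k / (l k + L)) (Ax k) (IHr L0).
rewrite divr_ge0 ?(ltW lL0) //= ler_pdivrMr // mul1r lerDl ltW // => /(_ isT).
congr A; rewrite scalerDr !scalerA; congr (_ *: _ + _ *: _); first exact: mulrC.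
by field; rewrite !lt0r_neq0.
Qed.

Lemma conv_hull_sub A B : @convex_set R 'rV[R]_n B -> A `<=` B -> conv_hull A `<=` B.
Proof. by move=> cB AB x; apply. Qed.

Lemma sub_conv_hull A : A `<=` conv_hull A.
Proof. exact: sub_gen_smallest. Qed.

Lemma convex_conv_hull A : @convex_set R 'rV[R]_n (conv_hull A).
Proof.
apply/convex_setP => x y p Ax Ay p01 B [cB AB].
by move/convex_setP : (cB); apply => //; [apply: Ax|apply: Ay].
Qed.

Lemma affine_conv p x y t : @affine_fun R n p ->
  p (t *: x + (1 - t) *: y) = t * p x + (1 - t) * p y.
Proof. by move=> [f [c pE]]; rewrite !pE dotDr !dotZr; ring. Qed.

Lemma affine_nonneg_convex p : affine_fun p -> @convex_set R 'rV[R]_n [set x | 0 <= p x].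
Proof.
move=> ap; apply/convex_setP => x y t /= px py /andP[t0 t1].
by rewrite affine_conv // addr_ge0 // mulr_ge0 // subr_ge0.
Qed.

Section Hulls.
Variables (s : 'I_n.+1 -> 'rV[R]_n) (beta : 'I_n.+1 -> 'rV[R]_n -> R).
Hypothesis hb : barycentric s beta.

Lemma bary_affineE p x : affine_fun p -> p x = \sum_j beta j x * p (s j).
Proof.
move=> [f [c pE]]; rewrite pE -[in LHS](bary_point hb x) dot_sumr.
under [RHS]eq_bigr do rewrite pE mulrDr.
rewrite big_split /= -mulr_suml (bary_sum hb) mul1r; congr (_ + _).
by apply: eq_bigr => j _; rewrite dotZr.
Qed.

Lemma simplexE : simplex s = bary_simplex beta.
Proof.
apply/seteqP; split.
  apply: conv_hull_sub => [|_ [k _ <-] j]; last by rewrite (bary_vertex hb) ler0n.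
  apply/convex_setP => x y p Sx Sy p01 j.
  by have /convex_setP := affine_nonneg_convex (bary_affine hb j); apply => /=.
move=> x Sx; rewrite -(bary_point hb x).
have := @convex_sum _ _ (index_enum 'I_n.+1) s (fun j => beta j x)
  (@convex_conv_hull (range s)) _ Sx.
rewrite (bary_sum hb) invr1 scale1r; apply => //.
by move=> j; apply: sub_conv_hull; exists j.
Qed.

Variables (u : 'rV[R]_n) (d : R).
Hypothesis u1 : dot u u = 1.
Let h x := dot u x - d.
Hypothesis h0 : forall j, 0 <= h (s j).

Let affine_h : affine_fun h. Proof. by exists u, (- d). Qed.

Let h_ge0 x : bary_simplex beta x -> 0 <= h x.
Proof.
move=> Sx; rewrite (bary_affineE x affine_h); apply: sumr_ge0 => j _.
by rewrite mulr_ge0.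
Qed.

(** Below every point [z] of the simplex, the hull contains exactly the segment
    from [z] to its mirror image: this union of segments is already convex
    because the height is affine. *)
Lemma conv_hull_reflectionE :
  conv_hull (simplex s `|` reflection u d @` simplex s) =
  [set x | exists z t, [/\ bary_simplex beta z, 0 <= t <= 2 * (dot u z - d) & x = z - t *: u]].
Proof.
rewrite simplexE; apply/seteqP; split.
  apply: conv_hull_sub.
    apply/convex_setP => _ _ p [z [t [Sz /andP[t0 t1] ->]]] [z' [t' [Sz' /andP[t0' t1'] ->]]].
    move=> p01; exists (p *: z + (1 - p) *: z'), (p * t + (1 - p) * t').
    have /andP[p0 p1] := p01; have q0 : 0 <= 1 - p by rewrite subr_ge0.
    split.
    - move=> j; have /convex_setP := affine_nonneg_convex (bary_affine hb j).
      by apply => /=.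
    - rewrite addr_ge0 ?mulr_ge0 //= -/(h _) affine_conv // mulrDr.
      by rewrite lerD // mulrCA ler_wpM2l.
    - by rewrite !scalerBr !scalerA [(_ * _ + _) *: u]scalerDl opprD addrACA.
  move=> x [Sx|[z Sz <-]].
    exists x, 0; split=> //; last by rewrite scale0r subr0.
    by rewrite lexx mulr_ge0 // h_ge0.
  exists z, (2 * h z); split=> //.
  by rewrite lexx mulr_ge0 // h_ge0.
move=> _ [z [t [Sz /andP[t0 t1] ->]]]; rewrite -/(h _) in t1.
have [hz0|hz0] := eqVneq (h z) 0.
  rewrite (_ : t = 0) ?scale0r ?subr0; first by apply: sub_conv_hull; left.
  by apply/eqP; rewrite eq_le t0 andbT -(mulr0 2) -hz0.
have hz : 0 < h z by rewrite lt0r hz0 h_ge0.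
have := @convex_conv_hull (bary_simplex beta `|` reflection u d @` bary_simplex beta).
move/convex_setP => /(_ (reflection u d z) z (t / (2 * h z))).
have -> : t / (2 * h z) *: reflection u d z + (1 - t / (2 * h z)) *: z = z - t *: u.
  rewrite /reflection -/(h z) scalerBr scalerA scalerBl scale1r divfK ?mulf_neq0 //.
  by rewrite addrC addrA subrK.
apply; [by apply: sub_conv_hull; right; exists z|by apply: sub_conv_hull; left|].
have h2 : 0 < 2 * h z by rewrite mulr_gt0.
by rewrite ler_pdivrMr // mul1r t1 divr_ge0 // ltW.
Qed.

Local Notation b := (bary_dir beta u).

(** The height grows with unit speed in the direction u. *)
Lemma bary_dir_height : \sum_j b j * (dot u (s j) - d) = 1.
Proof.
have := bary_affineE u affine_h; have := bary_affineE 0 affine_h => e0 eu.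
under eq_bigr do rewrite -/(h _) /bary_dir mulrBl.
by rewrite sumrB -eu -e0 /h u1 dot0r; ring.
Qed.

(** Moving a point of the hull in the direction u until it leaves the simplex, it
    exits through a facet opposite to a vertex i with [bary_dir beta u i < 0],
    and the time needed identifies the prism containing it. *)
Lemma conv_hull_reflection_prisms :
  conv_hull (simplex s `|` reflection u d @` simplex s) =
  [set x | exists2 i, i \in [seq i <- index_enum 'I_n.+1 | b i < 0] &
     prism beta u i (fun j => 2 * (dot u (s j) - d)) x].
Proof.
rewrite conv_hull_reflectionE; apply/seteqP; split=> x /=.
  move=> [z [t [Sz /andP[t0 t1] xE]]]; rewrite -/(h z) in t1.
  have [i0 bi0] : exists i, b i < 0.
    apply: contrapT => nb; have b0 j : 0 <= b j.
      by rewrite leNgt; apply/negP => bj; apply: nb; exists j.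
    have bz j : b j = 0.
      have /eqP := bary_dir_sum hb u; rewrite psumr_eq0 // => /allP bz.
      by apply/eqP; exact: bz (mem_index_enum j).
    have := bary_dir_height; rewrite big1 => [/eqP|j _]; last by rewrite bz mul0r.
    by rewrite eq_sym oner_eq0.
  case: (@Order.TotalTheory.arg_minP _ _ _ i0 (fun i => b i < 0)
    (fun i => beta i z / - b i) bi0) => i bi imin.
  exists i; first by rewrite mem_filter bi mem_index_enum.
  have nbi : - b i != 0 by rewrite oppr_eq0 ltr0_neq0.
  have betaE j : beta j x = beta j z - t * b j.
    by rewrite xE -scaleNr (affine_translate _ _ _ (bary_affine hb j)) mulNr.
  pose q := beta i z / - b i.
  have q0 : 0 <= q by rewrite divr_ge0 // oppr_ge0 ltW.
  have tauE : exit_time beta u i x = q + t.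
    by rewrite /exit_time betaE -/(b i) /q; field; rewrite -oppr_eq0.
  have yE j : exit_coord beta u i j x = beta j z + q * b j.
    by rewrite /exit_coord tauE betaE -/(b j); ring.
  split=> [j||].
  - rewrite yE; have [bj|bj] := leP 0 (b j); first by rewrite addr_ge0 // mulr_ge0.
    by have := imin j bj; rewrite -/q ler_pdivlMr ?oppr_gt0 // mulrN; lra.
  - by rewrite tauE addr_ge0.
  - rewrite tauE (_ : exit_interp _ _ _ _ _ = 2 * (h z + q)); first by lra.
    rewrite mulrDr (bary_affineE z affine_h) -[q]mulr1 -bary_dir_height !mulr_sumr -big_split /=.
    by apply: eq_bigr => j _; rewrite yE /h; ring.
move=> [i]; rewrite mem_filter => /andP[bi _] [y0 t0 tG].
set t := exit_time beta u i x in t0 tG.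
have betaE j : beta j (x + t *: u) = exit_coord beta u i j x.
  by rewrite (affine_translate _ _ _ (bary_affine hb j)).
exists (x + t *: u), t; split; last by rewrite addrK.
  by move=> j; rewrite betaE.
rewrite t0 -/(h _) (bary_affineE (x + t *: u) affine_h) mulr_sumr /=.
move: tG; congr (_ <= _); apply: eq_bigr => j _; rewrite betaE /h; ring.
Qed.

(** Two of the prisms only overlap where both facets are reached at the same
    time, which is a hyperplane. *)
Lemma vol_conv_hull_reflection :
  vol (conv_hull (simplex s `|` reflection u d @` simplex s)) =
  ((\sum_(i | b i < 0) - b i * \sum_(j | j != i) 2 * (dot u (s j) - d))%:E *
    vol (bary_simplex beta))%E.
Proof.
rewrite conv_hull_reflection_prisms.
rewrite (@vol_bigU_null _ _ _ _ _
    (fun i j => [set x | beta i x / - b i - beta j x / - b j = 0])).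
- rewrite big_filter.
  rewrite (eq_bigr (fun i => ((- b i * \sum_(j | j != i) 2 * (dot u (s j) - d))%:E *
    vol (bary_simplex beta))%E)).
    rewrite -ge0_sume_distrl.
      by rewrite sumEFin.
    move=> i bi; rewrite lee_fin mulr_ge0 ?oppr_ge0 ?(ltW bi) //.
    by apply: sumr_ge0 => j _; rewrite mulr_ge0 //; exact: h0.
  by move=> i bi; apply: (vol_prism hb bi (g := fun j => 2 * h (s j))) => j; rewrite mulr_ge0.
- by rewrite filter_uniq ?index_enum_uniq.
- by move=> i; rewrite mem_filter => /andP[bi _]; exact: (row_measurable_prism hb).
- move=> i j; rewrite !mem_filter => /andP[bi _] /andP[bj _] ij.
  have aq k : affine_fun (fun x => beta k x / - b k).
    rewrite (_ : (fun x => _) = fun x => (- b k)^-1 * beta k x).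
      exact: affineZ (bary_affine hb k).
    by apply/funext => x; rewrite mulrC.
  have aij := affineB (aq i) (aq j).
  split; first exact: row_measurable_affine_eq0 aij.
    move=> x [[/= yi _ _] [yj _ _]]; apply/eqP; rewrite subr_eq0 eq_le.
    rewrite (ler_pdivlMr (beta i x / - b i)) ?oppr_gt0 //.
    rewrite (ler_pdivlMr (beta j x / - b j)) ?oppr_gt0 //.
    move: (yi j) (yj i); rewrite /exit_coord /exit_time !mulrN => yij yji.
    by apply/andP; split; lra.
  apply: (vol_affine_eq0 (x := s i) (y := s j)) => //=.
  rewrite !(bary_vertex hb) !eqxx (negPf ij) [j == i]eq_sym (negPf ij) !mul0r subr0 sub0r !mul1r.
  have i0 : 0 < (- b i)^-1 by rewrite invr_gt0 oppr_gt0.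
  have j0 : 0 < (- b j)^-1 by rewrite invr_gt0 oppr_gt0.
  by apply/eqP => e; move: i0; rewrite e; lra.
Qed.
End Hulls.
End ConvexHulls.

(** * The volume ratio for a regular simplex *)

Section RegularSimplex.
Variables (R : realType) (n : nat) (s : 'I_n.+1 -> 'rV[R]_n).
Hypothesis n_gt0 : (0 < n)%N.
Hypothesis hs : regular_simplex_vertices s.

Lemma dot_ge0 (x : 'rV[R]_n) : 0 <= dot x x.
Proof. by apply: sumr_ge0 => i _; rewrite -expr2 sqr_ge0. Qed.

Lemma dot_eq0 (x : 'rV[R]_n) : dot x x = 0 -> x = 0.
Proof.
move/eqP; rewrite psumr_eq0 => [/allP x0|i _]; last by rewrite -expr2 sqr_ge0.
apply/rowP => i; rewrite mxE; apply/eqP.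
by have := x0 i (mem_index_enum i); rewrite mulf_eq0 orbb.
Qed.

Lemma enorm_sqr (x : 'rV[R]_n) : enorm x ^+ 2 = dot x x.
Proof. by rewrite /enorm sqr_sqrtr ?dot_ge0. Qed.

Let N : R := n.+1%:R.
Let N0 : N != 0. Proof. by rewrite pnatr_eq0. Qed.

Lemma affine_span_vertices (x : 'rV[R]_n) :
  exists2 l : 'I_n.+1 -> R, \sum_j l j = 1 & x = \sum_j l j *: s j.
Proof.
have [+ _] := hs; rewrite /affinely_independent; set M := \matrix_(i < n) _ => rf.
have uM : M \in unitmx by rewrite -row_free_unit.
have ulK (i : 'I_n) : unlift ord0 (lift ord0 i : 'I_n.+1) = Some i by exact: liftK.
pose y := (x - s ord0) *m invmx M.
have xE : x = s ord0 + y *m M by rewrite mulmxKV // addrC subrK.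
exists (fun j => if unlift ord0 j is Some i then y 0 i else 1 - \sum_i y 0 i).
  rewrite big_ord_recl unlift_none.
  rewrite [X in _ + X](eq_bigr (fun i => y 0 i)) => [|i _]; last by rewrite ulK.
  by rewrite subrK.
rewrite big_ord_recl unlift_none.
rewrite [X in _ + X](eq_bigr (fun i => y 0 i *: s (lift ord0 i))) => [|i _]; last by rewrite ulK.
rewrite {1}xE mulmx_sum_row scalerBl scale1r -addrA; congr (_ + _).
rewrite addrC scaler_suml -sumrB; apply: eq_bigr => i _.
by rewrite rowK scalerBr.
Qed.

(** Half of the squared edge length: this is the factor relating the Gram matrix
    of the vertices about their centroid to the projection orthogonal to the
    vector of ones. *)
Definition half_edge_sqr : R := dot (s (lift ord0 (Ordinal n_gt0)) - s ord0)
  (s (lift ord0 (Ordinal n_gt0)) - s ord0) / 2.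
Local Notation kappa := half_edge_sqr.

Lemma half_edge_sqr_gt0 : 0 < kappa.
Proof.
rewrite divr_gt0 // lt0r dot_ge0 andbT; apply/eqP => /dot_eq0 e0.
have [+ _] := hs; rewrite /affinely_independent; set M := \matrix_(i < n) _ => rf.
have : delta_mx 0 (Ordinal n_gt0) = 0 :> 'rV[R]_n.
  by apply: (row_free_inj rf); rewrite mul0mx -rowE rowK.
move/rowP/(_ (Ordinal n_gt0)); rewrite !mxE !eqxx => /eqP.
by rewrite oner_eq0.
Qed.

Lemma dist_sqr_vertices i j : dot (s i - s j) (s i - s j) = 2 * kappa * (i != j)%:R.
Proof.
have [->|ij] := eqVneq i j; first by rewrite subrr dot0r mulr0.
rewrite mulr1 /kappa mulrC divfK ?pnatr_eq0 //.
by have [_ [a ha]] := hs; rewrite -!enorm_sqr !ha // eq_sym neq_lift.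
Qed.

Definition centroid : 'rV[R]_n := n.+1%:R^-1 *: \sum_j s j.

(* by polarization from the distances of the vertices *)
Let dot_diff i k l :
  dot (s i - centroid) (s k - s l) = kappa * ((i == k)%:R - (i == l)%:R).
Proof.
have polar m : dot (s i - s m) (s k - s l) =
    kappa * ((i == k)%:R - (i == l)%:R + ((m == l)%:R - (m == k)%:R)).
  have e : 2 * dot (s i - s m) (s k - s l) =
      dot (s i - s l) (s i - s l) + dot (s m - s k) (s m - s k)
      - dot (s i - s k) (s i - s k) - dot (s m - s l) (s m - s l).
    rewrite !dotBl !dotBr (dotC (s l)) (dotC (s k) (s m)) (dotC (s k) (s i)) (dotC (s l) (s m)).
    ring.
  move: e; rewrite !dist_sqr_vertices; do 4 case: eqP => _ /=; lra.
have -> : s i - centroid = N^-1 *: \sum_m (s i - s m).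
  rewrite sumrB sumr_const card_ord scalerBr /centroid -/N; congr (_ - _).
  by rewrite -scaler_nat scalerA mulVf // scale1r.
rewrite dotZl dotC dot_sumr.
under eq_bigr do rewrite dotC polar.
rewrite -mulr_sumr big_split /= sumr_const card_ord sumrB -[_ *+ n.+1]mulr_natr -/N.
rewrite (bigD1 l) //= eqxx big1 => [|m /negPf->//].
rewrite (bigD1 k) //= eqxx big1 => [|m /negPf->//].
by rewrite /= mulr1n; field.
Qed.

(** Regularity makes the gradient of a barycentric coordinate a multiple of the
    vector from the centroid to the vertex. *)
Definition regular_bary j (x : 'rV[R]_n) : R :=
  n.+1%:R^-1 + kappa^-1 * dot (s j - centroid) (x - centroid).

Lemma affine_regular_bary j : affine_fun (regular_bary j).
Proof.
exists (kappa^-1 *: (s j - centroid)),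
  (N^-1 - kappa^-1 * dot (s j - centroid) centroid) => x.
by rewrite /regular_bary dotBr dotZl; ring.
Qed.

Lemma regular_bary_vertex j k : regular_bary j (s k) = (j == k)%:R.
Proof.
rewrite /regular_bary -/N.
have -> : s k - centroid = N^-1 *: \sum_m (s k - s m).
  rewrite sumrB sumr_const card_ord scalerBr /centroid -/N; congr (_ - _).
  by rewrite -scaler_nat scalerA mulVf // scale1r.
rewrite dotZr dot_sumr; under eq_bigr do rewrite dot_diff.
rewrite -mulr_sumr sumrB sumr_const card_ord.
rewrite (bigD1 j) //= eqxx big1 => [|m]; last by rewrite eq_sym => /negPf ->.
rewrite /= ?mulr1n -[_ *+ n.+1]mulr_natr -/N.
by field; rewrite nat1r N0 lt0r_neq0 // half_edge_sqr_gt0.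
Qed.

Lemma regular_barycentric : barycentric s regular_bary.
Proof.
have coords x : exists2 l : 'I_n.+1 -> R, \sum_j l j = 1 /\ x = \sum_j l j *: s j &
    forall j, regular_bary j x = l j.
  have [l l1 xE] := affine_span_vertices x; exists l => // j.
  have [f [c bE]] := affine_regular_bary j.
  rewrite bE xE dot_sumr -[c]mul1r -l1 mulr_suml -big_split /=.
  rewrite (bigD1 j) //= big1 => [|k kj].
    by rewrite addr0 dotZr -mulrDr -bE regular_bary_vertex eqxx mulr1.
  by rewrite dotZr -mulrDr -bE regular_bary_vertex eq_sym (negPf kj) mulr0.
split.
- exact: affine_regular_bary.
- exact: regular_bary_vertex.
- by move=> x; have [l [l1 _] bE] := coords x; under eq_bigr do rewrite bE.
- by move=> x; have [l [_ xE] bE] := coords x; under eq_bigr do rewrite bE.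
Qed.

Definition mean (h : 'I_n.+1 -> R) : R := n.+1%:R^-1 * \sum_j h j.

(** The volume ratio in terms of the heights of the vertices above the
    hyperplane; [vol_ratio_heights] is the reason for this formula. *)
Definition height_ratio (h : 'I_n.+1 -> R) : R :=
  2 * (\sum_(i | h i < mean h) (mean h - h i) * \sum_(j | j != i) h j) /
  \sum_j (h j - mean h) ^+ 2.

Section Heights.
Variables (u : 'rV[R]_n) (d : R).
Hypothesis u1 : enorm u = 1.
Local Notation h := (fun j => dot u (s j) - d).

Let uu : dot u u = 1. Proof. by rewrite -enorm_sqr u1 expr1n. Qed.

(** Hence the facets through which one leaves the simplex in the direction u are
    those opposite to the vertices whose height is below the mean. *)
Lemma regular_bary_dir j :
  bary_dir regular_bary u j = kappa^-1 * (h j - mean h).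
Proof.
rewrite /bary_dir /regular_bary addrAC opprD addrA subrr add0r sub0r dotBr.
have -> : mean h = dot u centroid - d.
  rewrite /mean /centroid -/N dotZr dot_sumr sumrB sumr_const card_ord -[_ *+ n.+1]mulr_natr -/N.
  by field.
by rewrite dotNr (dotC _ u) dotBr; ring.
Qed.

Let sum_dev (h : 'I_n.+1 -> R) :
  \sum_j (h j - mean h) ^+ 2 = \sum_j (h j - mean h) * h j.
Proof.
apply/eqP; rewrite -subr_eq0 -sumrB; apply/eqP.
under eq_bigr do rewrite expr2 -mulrBr addrAC subrr sub0r.
rewrite -mulr_suml sumrB sumr_const card_ord -[_ *+ n.+1]mulr_natr /mean -/N.
by rewrite mulrAC mulVf // mul1r subrr mul0r.
Qed.

(** The fact that u is a unit vector, expressed by the heights. *)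
Lemma sum_dev_heights : \sum_j (h j - mean h) ^+ 2 = kappa.
Proof.
have := bary_dir_height regular_barycentric d uu.
under eq_bigr do rewrite regular_bary_dir -mulrA.
rewrite -mulr_sumr sum_dev => /(congr1 ( *%R kappa)).
by rewrite mulr1 mulVKf // lt0r_neq0 // half_edge_sqr_gt0.
Qed.

Hypothesis h0 : forall j, 0 <= h j.

Lemma vol_ratio_heights : vol_ratio (simplex s) u d = (height_ratio h)%:E.
Proof.
rewrite /vol_ratio (vol_conv_hull_reflection regular_barycentric uu h0).
rewrite (simplexE regular_barycentric).
have := vol_bary_simplex_gt0 regular_barycentric.
have := vol_bary_simplex_fin regular_barycentric.
case: (vol _) => [v| |] // _; rewrite lte_fin => v0.
rewrite /height_ratio sum_dev_heights.
have k0 := half_edge_sqr_gt0.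
rewrite inver (gt_eqF v0) -!EFinM mulfK ?lt0r_neq0 //; congr EFin.
rewrite [RHS]mulrAC [RHS]mulr_sumr; apply: eq_big => i.
  by rewrite regular_bary_dir pmulr_rlt0 ?invr_gt0 // subr_lt0.
by move=> _; rewrite regular_bary_dir -mulr_sumr; field; rewrite lt0r_neq0.
Qed.

Lemma height_ratio_scale (g : 'I_n.+1 -> R) c : 0 < c ->
  height_ratio (fun j => c * g j) = height_ratio g.
Proof.
move=> c0; have mE : mean (fun j => c * g j) = c * mean g.
  by rewrite /mean -mulr_sumr mulrCA.
rewrite /height_ratio mE (eq_bigl (fun i => g i < mean g)); last first.
  by move=> i; rewrite ltr_pM2l.
under eq_bigr do rewrite -mulr_sumr -mulrBr mulrACA.
under [X in _ / X]eq_bigr do rewrite -mulrBr exprMn.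
rewrite -!mulr_sumr -expr2 mulrCA invfM mulrACA divff ?mul1r //.
by rewrite expf_neq0 // lt0r_neq0.
Qed.
End Heights.

(** Any nonconstant family of numbers is, up to scaling, the family of heights
    of the vertices above some hyperplane. *)
Lemma exists_direction (g : 'I_n.+1 -> R) : 0 < \sum_j (g j - mean g) ^+ 2 ->
  exists u d c, [/\ enorm u = 1, 0 < c & forall j, dot u (s j) - d = c * g j].
Proof.
move=> g0; pose v := \sum_j (g j - mean g) *: (s j - centroid).
have vE k l : dot v (s k - s l) = kappa * (g k - g l).
  rewrite dotC dot_sumr.
  under eq_bigr do rewrite dotZr dotC dot_diff mulrCA mulrBr.
  rewrite -mulr_sumr sumrB (bigD1 k) //= eqxx big1 => [|j /negPf->]; last by rewrite mulr0.
  rewrite (bigD1 l) //= eqxx big1 => [|j /negPf->]; last by rewrite mulr0.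
  by rewrite /= mulr1n; ring.
have v0 : 0 < enorm v.
  rewrite lt_def sqrtr_ge0 andbT; apply/eqP => ev.
  have {ev} v0 : v = 0 by apply: dot_eq0; rewrite -enorm_sqr ev expr0n.
  have gE k : g k = g ord0.
    have /eqP := vE k ord0; rewrite v0 dotC dot0r eq_sym mulf_eq0.
    by rewrite (gt_eqF half_edge_sqr_gt0) /= subr_eq0 => /eqP.
  have mE : mean g = g ord0.
    rewrite /mean -/N; under eq_bigr do rewrite gE.
    by rewrite sumr_const card_ord -[_ *+ n.+1]mulr_natr -/N mulrC mulfK.
  by move: g0; rewrite big1 ?ltxx // => j _; rewrite mE gE subrr expr0n.
exists ((enorm v)^-1 *: v), (dot ((enorm v)^-1 *: v) (s ord0) - kappa / enorm v * g ord0),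
  (kappa / enorm v); split.
- apply/eqP; rewrite -(@eqrXn2 _ 2) // ?sqrtr_ge0 // enorm_sqr dotZl dotZr -enorm_sqr.
  by rewrite expr1n; apply/eqP; field; rewrite lt0r_neq0.
- by rewrite divr_gt0 // half_edge_sqr_gt0.
- move=> j; rewrite opprB addrA addrAC -dotBr dotZl vE; ring.
Qed.

End RegularSimplex.

Lemma vol_ratioN (R : realType) n (A : set 'rV[R]_n) u d :
  vol_ratio A (- u) (- d) = vol_ratio A u d.
Proof.
rewrite /vol_ratio (_ : reflection (- u) (- d) = reflection u d) //.
apply/funext => x; rewrite /reflection dotNl.
by congr (x - _); rewrite scalerN -scaleNr; congr (_ *: _); ring.
Qed.

(** * The extremal problem for the heights *)

Section HeightInequality.
Variable R : realType.

Lemma sum_sqr_sub (I : finType) (P : pred I) (y : I -> R) c :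
  \sum_(i | P i) (y i - c) ^+ 2 =
  \sum_(i | P i) y i ^+ 2 - 2 * c * (\sum_(i | P i) y i) + #|P|%:R * c ^+ 2.
Proof.
have -> : #|P|%:R * c ^+ 2 = \sum_(i | P i) c ^+ 2 by rewrite sumr_const mulr_natl.
rewrite mulr_sumr -sumrB -big_split /=.
by apply: eq_bigr => i _; ring.
Qed.

(** The Cauchy-Schwarz inequality against a constant family. *)
Lemma sqr_sum_le (I : finType) (P : pred I) (y : I -> R) :
  (\sum_(i | P i) y i) ^+ 2 <= #|P|%:R * \sum_(i | P i) y i ^+ 2.
Proof.
have [P0|P0] := posnP #|P|.
  by rewrite big1 ?expr0n ?P0 ?mul0r // => i Pi; have := card0_eq P0 i; rewrite unfold_in Pi.
set k : R := #|P|%:R; have k0 : 0 < k by rewrite ltr0n.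
set S := \sum_(i | P i) y i.
have : 0 <= \sum_(i | P i) (y i - S / k) ^+ 2 by apply: sumr_ge0 => i _; exact: sqr_ge0.
rewrite sum_sqr_sub -/k -/S => h.
rewrite -subr_ge0 (_ : _ - _ = k * (\sum_(i | P i) y i ^+ 2 - 2 * (S / k) * S + k * (S / k) ^+ 2)).
  by rewrite mulr_ge0 // ltW.
by field; rewrite lt0r_neq0.
Qed.

Lemma sqr_sum_eq (I : finType) (P : pred I) (y : I -> R) i : P i ->
  (\sum_(i | P i) y i) ^+ 2 = #|P|%:R * \sum_(i | P i) y i ^+ 2 ->
  #|P|%:R * y i = \sum_(i | P i) y i.
Proof.
move=> Pi; set k : R := #|P|%:R.
have k0 : 0 < k by rewrite ltr0n; apply/card_gt0P; exists i.
set S := \sum_(i | P i) y i => e.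
have : \sum_(i | P i) (y i - S / k) ^+ 2 = 0.
  rewrite sum_sqr_sub -/k -/S; apply: (mulfI (lt0r_neq0 k0)).
  by rewrite mulr0 !mulrDr -e; field; rewrite lt0r_neq0.
move=> /eqP; rewrite psumr_eq0 => [/allP h|j _]; last exact: sqr_ge0.
have := h i (mem_index_enum i); rewrite Pi /= sqrf_eq0 subr_eq0 => /eqP ->.
by rewrite mulrC divfK // lt0r_neq0.
Qed.

Section Data.
Variables (n : nat) (h : 'I_n.+1 -> R) (i0 : 'I_n.+1).
Hypotheses (h0 : forall j, 0 <= h j) (hi0 : h i0 = 0).
Hypothesis (hD : 0 < \sum_j (h j - mean h) ^+ 2).
Local Notation m := (mean h).
Local Notation A := (fun i => h i < m).
Definition depth i := m - h i.
Local Notation y := depth.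

Lemma mean_gt0 : 0 < m.
Proof.
have m0 : 0 <= m by rewrite /mean mulr_ge0 ?invr_ge0 // sumr_ge0.
rewrite lt0r m0 andbT; apply/eqP => me.
have : \sum_j h j = 0.
  by move/eqP: me; rewrite /mean mulf_eq0 invr_eq0 pnatr_eq0 /= => /eqP.
move=> /eqP; rewrite psumr_eq0 // => /allP hz.
move: hD; rewrite big1 ?ltxx // => j _.
by have /eqP -> := hz j (mem_index_enum j); rewrite me subrr expr0n.
Qed.

Let sum_h : \sum_j h j = n.+1%:R * m.
Proof. by rewrite /mean mulrA divff ?mul1r // pnatr_eq0. Qed.

Let sum_y : \sum_j y j = 0.
Proof.
by rewrite sumrB sum_h sumr_const card_ord mulr_natl subrr.
Qed.

Definition below_count := #|A|.
Definition above_count := #|[pred i | ~~ A i]|.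
Definition below_sum := \sum_(i | A i) y i.
Definition below_sqr := \sum_(i | A i) y i ^+ 2.
Definition above_sqr := \sum_(i | ~~ A i) y i ^+ 2.
Local Notation k := below_count.
Local Notation l := above_count.
Local Notation P := below_sum.
Local Notation Q := below_sqr.
Local Notation Q' := above_sqr.

Let Ai0 : h i0 < m. Proof. by rewrite hi0 mean_gt0. Qed.

Lemma counts : (k + l = n.+1)%N.
Proof. by rewrite -[RHS]card_ord -(cardC A). Qed.

Lemma below_count_gt0 : (0 < k)%N.
Proof. by apply/card_gt0P; exists i0. Qed.

Let sum_above : \sum_(i | ~~ A i) y i = - P.
Proof. by have := sum_y; rewrite (bigID A) /= => /eqP; rewrite addrC addr_eq0 => /eqP. Qed.

Let y_i0 : y i0 = m. Proof. by rewrite /depth hi0 subr0. Qed.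

Let y_ge0 i : h i < m -> 0 <= y i. Proof. by move=> Ai; rewrite subr_ge0 ltW. Qed.

Lemma below_sum_ge : m <= P.
Proof.
rewrite /P (bigD1 i0) //= y_i0 lerDl; apply: sumr_ge0 => i /andP[Ai _].
exact: y_ge0.
Qed.

Lemma below_sqr_ge : m ^+ 2 <= Q.
Proof.
by rewrite /Q (bigD1 i0) //= y_i0 lerDl; apply: sumr_ge0 => i _; exact: sqr_ge0.
Qed.

Lemma above_cauchy : P ^+ 2 <= l%:R * Q'.
Proof. by rewrite -sqrrN -sum_above; exact: sqr_sum_le. Qed.

(** Cauchy-Schwarz for the depths other than the largest one, m, which is that
    of the vertex on the hyperplane. *)
Lemma below_cauchy : (P - m) ^+ 2 <= (k.-1)%:R * (Q - m ^+ 2).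
Proof.
rewrite /P /Q !(bigD1 (P := A) i0) //= y_i0 ![m + _ - m]addrAC.
rewrite ![m ^+ 2 + _]addrC addrK [m - m]subrr add0r.
have -> : k.-1 = #|[pred i | A i & i != i0]|.
  by rewrite /k (cardD1 i0) unfold_in /= Ai0 add1n /=; apply: eq_card => i; rewrite !inE andbC.
exact: sqr_sum_le.
Qed.

Lemma above_count_gt0 : (0 < l)%N.
Proof.
rewrite lt0n; apply/eqP => l0; have := above_cauchy; rewrite l0 mul0r.
have := below_sum_ge; have := mean_gt0; nra.
Qed.

Lemma height_ratioE : height_ratio h = 2 * (n%:R * m * P + Q) / (Q + Q').
Proof.
rewrite /height_ratio; congr (_ * _ / _).
  rewrite /P /Q mulr_sumr -big_split; apply: eq_bigr => i Ai /=.
  have -> : \sum_(j | j != i) h j = n.+1%:R * m - h i.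
    by rewrite -sum_h [in RHS](bigD1 i) //= addrAC subrr add0r.
  by rewrite /depth -natr1; ring.
rewrite (bigID A) /=; congr (_ + _); apply: eq_bigr => i _; rewrite /depth; ring.
Qed.

Lemma sum_sqr_gt0 : 0 < Q + Q'.
Proof.
have q : m ^+ 2 <= Q := below_sqr_ge.
have : 0 <= Q' by apply: sumr_ge0 => i _; exact: sqr_ge0.
have := mean_gt0; nra.
Qed.

(** The equality case of [above_cauchy]. *)
Lemma one_below_eq j : k = 1%N -> P ^+ 2 = l%:R * Q' -> j != i0 -> l%:R * y j = - P.
Proof.
move=> k1 e ji; rewrite -sum_above; apply: sqr_sum_eq.
  apply/negP => Aj; move: k1; rewrite /k (cardD1 i0) unfold_in /= Ai0 => -[] /card0_eq/(_ j).
  by rewrite !inE ji unfold_in Aj.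
by rewrite sum_above sqrrN.
Qed.
End Data.
End HeightInequality.

Section Scalar.
Variable R : realType.

(** The parameters of the bounds below stand for the quantities [below_sum],
    [below_sqr] and [above_sqr], with k heights below the mean and l others; only
    the Cauchy-Schwarz estimates between them matter. *)
Lemma ratio_bound_one_below n (m P Q Q' : R) : (0 < n)%N -> 0 < m -> m <= P -> m ^+ 2 <= Q ->
  P ^+ 2 <= n%:R * Q' -> (P - m) ^+ 2 <= 0 ->
  n%:R * m * P + Q <= n%:R * (Q + Q') /\
  (n%:R * m * P + Q = n%:R * (Q + Q') -> P ^+ 2 = n%:R * Q').
Proof.
move=> n0 m0 mP mQ PQ Pm.
have {Pm mP} PE : P = m by apply/eqP; rewrite -subr_eq0 -sqrf_eq0 eq_le Pm sqr_ge0.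
rewrite {}PE in PQ *.
have n1 : 1 <= n%:R :> R by rewrite ler1n.
have h : 0 <= (n%:R - 1) * (Q - m ^+ 2) by rewrite mulr_ge0 ?subr_ge0.
split; first by nra.
by nra.
Qed.

(** Substituting the Cauchy-Schwarz estimates leaves a quadratic form in m and
    in the sum t of the other positive depths; it is positive definite for the
    six pairs (n, k). *)
Lemma ratio_bound_le4 n k l (m P Q Q' : R) : (1 <= n <= 4)%N -> (k + l = n.+1)%N ->
  (1 < k)%N -> (0 < l)%N -> 0 < m -> m <= P -> m ^+ 2 <= Q ->
  P ^+ 2 <= l%:R * Q' -> (P - m) ^+ 2 <= k.-1%:R * (Q - m ^+ 2) ->
  n%:R * m * P + Q < n%:R * (Q + Q').
Proof.
move=> n14 kl k1 l0 m0 mP mQ.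
have {}kl : l = (n.+1 - k)%N by rewrite -kl addKn.
rewrite {}kl in l0 *; move: n14 k1 l0.
case: n => [|[|[|[|[|n]]]]] //= _; case: k => [|[|[|[|[|k]]]]] //= _ _ h1 h2;
  pose t := P - m; have tE : P = t + m by rewrite /t subrK.
all: rewrite {}tE in h1 h2 mP *; have {mP} t0 : 0 <= t by lra.
all: clearbody t; have tm : 0 <= t * m by rewrite mulr_ge0 // ltW.
all: have mm : 0 < m * m by rewrite mulr_gt0.
all: have tt : 0 <= t * t by rewrite mulr_ge0.
(* the square needed for n = 4 and k = 2, where the cross term is negative *)
all: have mt : 0 <= (m - 2 * t) * (m - 2 * t) by rewrite -expr2 sqr_ge0.
all: rewrite ?subSS ?subn0 ?expr2 in h1 h2 *; nra.
Qed.

(** The equation for lam makes the discriminant vanish in the only critical case,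
    that of two heights below the mean. *)
Lemma ratio_bound_5 (lam : R) k l m P Q Q' : 5 < lam -> lam * (6 * lam - 30) = 1 ->
  (k + l = 6)%N -> (0 < k)%N -> (0 < l)%N -> 0 < m -> m <= P -> m ^+ 2 <= Q ->
  P ^+ 2 <= l%:R * Q' -> (P - m) ^+ 2 <= k.-1%:R * (Q - m ^+ 2) ->
  5 * m * P + Q <= lam * (Q + Q').
Proof.
move=> lam5 lamE kl k1 l0 m0 mP mQ.
have {}kl : l = (6 - k)%N by rewrite -kl addKn.
rewrite {}kl in l0 *; move: k1 l0.
pose t := P - m; have tE : P = t + m by rewrite /t subrK.
case: k => [|[|[|[|[|[|k]]]]]] //= _ _ h1 h2.
  rewrite mul0r in h2; have [h _] := ratio_bound_one_below (n := 5) isT m0 mP mQ h1 h2.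
  by nra.
all: rewrite {}tE in h1 h2 mP *; have {mP} t0 : 0 <= t by lra.
all: clearbody t; have tm : 0 <= t * m by rewrite mulr_ge0 // ltW.
all: have mm : 0 < m * m by rewrite mulr_gt0.
all: have tt : 0 <= t * t by rewrite mulr_ge0.
all: rewrite ?subSS ?subn0 ?mul1r addrK in h1 h2.
- have sq : 0 <= ((5 * lam - 4) * t + (lam - 10) * m) ^+ 2 by exact: sqr_ge0.
  have w0 : 0 < 5 * lam - 4 by lra.
  have : 0 <= (5 * lam - 4) * t ^+ 2 + (2 * lam - 20) * (t * m) + (5 * lam - 24) * m ^+ 2.
    rewrite -(pmulr_rge0 _ w0).
    set X := (X in 0 <= X); rewrite (_ : X = ((5 * lam - 4) * t + (lam - 10) * m) ^+ 2
        + 4 * (lam * (6 * lam - 30) - 1) * m ^+ 2); last by rewrite /X; ring.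
    by rewrite lamE subrr mulr0 mul0r addr0.
  have q1 : 0 <= (lam - 1) * (Q - m ^+ 2 - t ^+ 2).
    by rewrite mulr_ge0 //; lra.
  have q2 : 0 <= lam * (4 * Q' - (t + m) ^+ 2) by rewrite mulr_ge0 //; lra.
  by rewrite ?expr2 in q1 q2 *; lra.
all: have : 5 * m * (t + m) + Q <= 5 * (Q + Q'); last by nra.
all: have mt : 0 <= (m - 2 * t) * (m - 2 * t) by rewrite -expr2 sqr_ge0.
all: rewrite ?subSS ?subn0 ?expr2 in h1 h2 *; nra.
Qed.
End Scalar.

(** * From heights to supporting hyperplanes *)

Section Supporting.
Variables (R : realType) (n : nat) (s : 'I_n.+1 -> 'rV[R]_n).
Hypothesis n_gt0 : (0 < n)%N.
Hypothesis hs : regular_simplex_vertices s.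
Let hb := regular_barycentric n_gt0 hs.

Lemma vertex_simplex j : simplex s (s j).
Proof. by apply: sub_conv_hull; exists j. Qed.

Lemma supporting_heights u d : supporting (simplex s) u d ->
  simplex s `<=` upper_halfspace u d ->
  (forall j, 0 <= dot u (s j) - d) /\ exists j, dot u (s j) - d = 0.
Proof.
move=> [_ [x [/= xu Sx]] _] up.
have h0 j : 0 <= dot u (s j) - d by rewrite subr_ge0; exact: up (vertex_simplex j).
split=> //; apply: contrapT => nz.
have hpos j : 0 < dot u (s j) - d.
  by rewrite lt0r h0 andbT; apply/eqP => hj; apply: nz; exists j.
have Bx : bary_simplex (regular_bary s n_gt0) x by rewrite -(simplexE hb).
have := bary_affineE hb x (ex_intro _ u (ex_intro _ (- d) (fun=> erefl _))).
rewrite xu subrr => /esym/eqP; rewrite psumr_eq0 => [/allP bz|j _]; last first.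
  by rewrite mulr_ge0 //; exact: Bx.
have := bary_sum hb x; rewrite big1 => [/eqP|j _]; first by rewrite eq_sym oner_eq0.
by have := bz j (mem_index_enum j); rewrite mulf_eq0 (gt_eqF (hpos j)) orbF => /eqP.
Qed.

Lemma heights_supporting u d i0 : enorm u = 1 -> (forall j, 0 <= dot u (s j) - d) ->
  dot u (s i0) - d = 0 -> supporting (simplex s) u d /\ simplex s `<=` upper_halfspace u d.
Proof.
move=> u1 h0 hi0.
have up : simplex s `<=` upper_halfspace u d.
  move=> x; rewrite (simplexE hb) => Bx; rewrite /upper_halfspace /= -subr_ge0.
  rewrite (bary_affineE hb x (ex_intro _ u (ex_intro _ (- d) (fun=> erefl _)))).
  by apply: sumr_ge0 => j _; rewrite mulr_ge0 //; exact: Bx.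
split=> //; split; [exact: u1| |by left].
exists (s i0); split; last exact: vertex_simplex.
by apply/eqP; rewrite -subr_eq0 hi0.
Qed.

Lemma vol_ratios_ubound (lam : R) :
  (forall h i0, (forall j, 0 <= h j) -> h i0 = 0 ->
     0 < \sum_j (h j - mean h) ^+ 2 -> height_ratio (n := n) h <= lam) ->
  ubound (vol_ratios (simplex s)) lam%:E.
Proof.
move=> bound.
have up u d : supporting (simplex s) u d -> simplex s `<=` upper_halfspace u d ->
    (vol_ratio (simplex s) u d <= lam%:E)%E.
  move=> su sup; have [h0 [j hj]] := supporting_heights su sup.
  have [u1 _ _] := su.
  rewrite (vol_ratio_heights n_gt0 hs u1 h0) lee_fin; apply: bound h0 hj _.
  by rewrite (sum_dev_heights n_gt0 hs d u1) half_edge_sqr_gt0.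
move=> _ [u [d [su ->]]]; have [u1 [x [xu Sx]] [sup|lo]] := su; first exact: up.
have lo' : simplex s `<=` upper_halfspace (- u) (- d).
  by move=> z /lo; rewrite /upper_halfspace /lower_halfspace /= dotNl lerN2.
rewrite -vol_ratioN; apply: up => //; split; last by left.
  by rewrite /enorm dotNl dotC dotNl opprK.
by exists x; split=> //; rewrite /hyperplane /= dotNl xu.
Qed.

Lemma vol_ratios_mem (h : 'I_n.+1 -> R) i0 : (forall j, 0 <= h j) -> h i0 = 0 ->
  0 < \sum_j (h j - mean h) ^+ 2 ->
  vol_ratios (simplex s) (height_ratio h)%:E.
Proof.
move=> h0 hi0 /(exists_direction n_gt0 hs)[u [d [c [u1 c0 uh]]]].
have uh0 j : 0 <= dot u (s j) - d by rewrite uh mulr_ge0 // ltW.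
have ui0 : dot u (s i0) - d = 0 by rewrite uh hi0 mulr0.
have [su _] := heights_supporting u1 uh0 ui0.
exists u, d; split=> //; rewrite (vol_ratio_heights n_gt0 hs u1 uh0).
by rewrite -(height_ratio_scale h c0); congr (height_ratio _)%:E; apply/funext.
Qed.
End Supporting.

Section Extremal.
Variable R : realType.

(** * The extremal values *)

Section LowDimension.
Variables (n : nat) (h : 'I_n.+1 -> R) (i0 : 'I_n.+1).
Hypotheses (n14 : (1 <= n <= 4)%N) (h0 : forall j, 0 <= h j) (hi0 : h i0 = 0).
Hypothesis hD : 0 < \sum_j (h j - mean h) ^+ 2.

Let num := n%:R * mean h * below_sum h + below_sqr h.
Let den := below_sqr h + above_sqr h.

Let num_den : num <= n%:R * den /\
  (num = n%:R * den -> below_count h = 1%N /\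
    below_sum h ^+ 2 = (above_count h)%:R * above_sqr h).
Proof.
have m0 := mean_gt0 h0 hD; have mP := below_sum_ge h0 hi0 hD.
have mQ := below_sqr_ge h0 hi0 hD; have PQ := above_cauchy h.
have Pm := below_cauchy h0 hi0 hD; have kl := counts h.
have k0 := below_count_gt0 h0 hi0 hD; have l0 := above_count_gt0 h0 hi0 hD.
have n0 : (0 < n)%N by case/andP: n14.
have [k1|k1] := leqP (below_count h) 1.
  have {k0 k1} kE : below_count h = 1%N by apply/eqP; rewrite eqn_leq k1.
  move: kl; rewrite kE add1n => -[lE]; rewrite lE in PQ l0 *.
  rewrite kE mul0r in Pm.
  by have [le_nd eq_nd] := ratio_bound_one_below n0 m0 mP mQ PQ Pm;
    split=> // e; split=> //; exact: eq_nd.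
have lt_nd := ratio_bound_le4 n14 kl k1 l0 m0 mP mQ PQ Pm.
by split; [exact: ltW|move=> e; move: lt_nd; rewrite -/num -/den e ltxx].
Qed.

Let hE : height_ratio h = 2 * num / den. Proof. exact: height_ratioE. Qed.
Let den0 : 0 < den. Proof. exact: (sum_sqr_gt0 h0 hi0 hD). Qed.

Lemma height_ratio_le : height_ratio h <= 2 * n%:R.
Proof. by rewrite hE ler_pdivrMr // -mulrA ler_pM2l //; case: num_den. Qed.

Lemma height_ratio_eq : height_ratio h = 2 * n%:R ->
  exists2 t, 0 < t & forall j, j != i0 -> h j - mean h = t.
Proof.
have [_ num_eq] := num_den.
rewrite hE => e; have {e} : num = n%:R * den.
  apply: (mulfI (x := 2)); first by rewrite pnatr_eq0.
  by rewrite [RHS]mulrA -e divfK ?lt0r_neq0.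
move=> /num_eq[k1 e].
have l0 : 0 < (above_count h)%:R :> R by rewrite ltr0n (above_count_gt0 h0 hi0 hD).
exists (below_sum h / (above_count h)%:R).
  by rewrite divr_gt0 // (lt_le_trans (mean_gt0 h0 hD)) // (below_sum_ge h0 hi0 hD).
move=> j ji; have yj := one_below_eq h0 hi0 hD k1 e ji.
apply: (mulfI (lt0r_neq0 l0)); rewrite [RHS]mulrC divfK ?lt0r_neq0 //.
by rewrite -[below_sum h]opprK -yj /depth; ring.
Qed.
End LowDimension.

Section OneBelow.
Variable n : nat.
Definition one_below (j : 'I_n.+1) : R := (j != ord0)%:R.
Local Notation h := one_below.
Hypothesis n_gt0 : (0 < n)%N.

Let N0 : n.+1%:R != 0 :> R. Proof. by rewrite pnatr_eq0. Qed.

Let sum_h : \sum_(j | j != ord0) h j = n%:R.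
Proof.
rewrite (eq_bigr (fun=> 1)) => [|j j0]; last by rewrite /one_below j0.
by rewrite sumr_const cardC1 card_ord.
Qed.

Let mean_h : mean h = n%:R / n.+1%:R.
Proof. by rewrite /mean (bigD1 ord0) //= sum_h /one_below eqxx add0r mulrC. Qed.

Let dev_h : \sum_j (h j - mean h) ^+ 2 = n%:R / n.+1%:R.
Proof.
rewrite (bigD1 ord0) //= (eq_bigr (fun=> (1 - mean h) ^+ 2)) => [|j j0]; last by rewrite /one_below j0.
rewrite sumr_const cardC1 card_ord mean_h /one_below eqxx -mulr_natr -natr1 /=.
by field; rewrite natr1.
Qed.

Lemma dev_one_below_gt0 : 0 < \sum_j (h j - mean h) ^+ 2.
Proof. by rewrite dev_h divr_gt0 ?ltr0n. Qed.

Lemma height_ratio_one_below : height_ratio h = 2 * n%:R.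
Proof.
rewrite /height_ratio (eq_bigl (pred1 ord0)) => [|j].
  rewrite big_pred1_eq sum_h dev_h mean_h /one_below eqxx subr0.
  by field; rewrite nat1r N0 pnatr_eq0 -lt0n n_gt0.
rewrite mean_h /one_below /=; case: (eqVneq j ord0) => _.
  by rewrite /= divr_gt0 ?ltr0n.
by rewrite /= ltr_pdivlMr ?ltr0n // mul1r ltr_nat ltnNge leqnSn.
Qed.
End OneBelow.

Section DimensionFive.
Variable lam : R.
Hypotheses (lam5 : 5 < lam) (lamE : lam * (6 * lam - 30) = 1).

Let w0 : 0 < 5 * lam - 4. Proof. by have := lam5; lra. Qed.
Let lam10 : lam < 10.
Proof.
rewrite ltNge; apply/negP => l10.
have : 0 <= (lam - 10) * (6 * lam - 30) by rewrite mulr_ge0; lra.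
have := lamE; lra.
Qed.

(** The double root of the quadratic polynomial in the bound for two heights
    below the mean, that is, the ratio of the two depths in the extremal case. *)
Definition depth_ratio : R := (10 - lam) / (5 * lam - 4).
Local Notation t := depth_ratio.

Let tE : t * (5 * lam - 4) = 10 - lam. Proof. by rewrite /depth_ratio divfK // lt0r_neq0. Qed.
Let t0 : 0 < t. Proof. by rewrite /depth_ratio divr_gt0 // subr_gt0. Qed.
Let t1 : t < 1. Proof. by rewrite /depth_ratio ltr_pdivrMr //; have := lam5; lra. Qed.

(** Normalized to have mean 1. *)
Definition two_below (j : 'I_6) : R :=
  if val j is 0 then 0 else if val j is 1 then 1 - t else 1 + (1 + t) / 4.

Local Notation h := two_below.

Lemma two_below_ge0 j : 0 <= h j.
Proof. by have := t0; have := t1; rewrite /two_below; case: (val j) => [|[|k]]; lra. Qed.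

Let mean_h : mean h = 1.
Proof. by rewrite /mean !big_ord_recl big_ord0 /two_below /=; field. Qed.

Let dev_h : \sum_j (h j - mean h) ^+ 2 = 1 + t ^+ 2 + (1 + t) ^+ 2 / 4.
Proof. by rewrite mean_h !big_ord_recl big_ord0 /two_below /=; field. Qed.

Lemma dev_two_below_gt0 : 0 < \sum_j (h j - mean h) ^+ 2.
Proof. by rewrite dev_h addr_gt0 ?divr_gt0 ?addr_gt0 ?exprn_gt0 ?addr_gt0 // ?ltr01. Qed.

Lemma height_ratio_two_below : height_ratio h = 2 * lam.
Proof.
have D0 := dev_two_below_gt0.
rewrite /height_ratio; apply: (mulIf (lt0r_neq0 D0)); rewrite divfK ?lt0r_neq0 //.
rewrite dev_h mean_h big_mkcond.
under eq_bigr do rewrite big_mkcond.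
rewrite !big_ord_recl !big_ord0 /two_below /=.
have -> : (1 - t < 1) = true by apply/idP; have := t0; lra.
have -> : (1 + (1 + t) / 4 < 1) = false by apply/negbTE/negP; have := t0; lra.
rewrite ltr01.
have q : (5 * lam - 4) * t ^+ 2 + (2 * lam - 20) * t + (5 * lam - 24) = 0.
  apply: (mulfI (lt0r_neq0 w0)); rewrite mulr0.
  transitivity ((t * (5 * lam - 4)) ^+ 2 + (2 * lam - 20) * (t * (5 * lam - 4))
    + (5 * lam - 4) * (5 * lam - 24)); first by ring.
  rewrite tE; transitivity (4 * (lam * (6 * lam - 30) - 1)); first by ring.
  by rewrite lamE subrr mulr0.
by lra.
Qed.

Lemma height_ratio_le_5 (g : 'I_6 -> R) i0 : (forall j, 0 <= g j) -> g i0 = 0 ->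
  0 < \sum_j (g j - mean g) ^+ 2 -> height_ratio g <= 2 * lam.
Proof.
move=> g0 gi0 gD; rewrite height_ratioE ler_pdivrMr ?(sum_sqr_gt0 g0 gi0 gD) //.
rewrite -[leRHS]mulrA ler_pM2l //; apply: (ratio_bound_5 lam5 lamE (counts g)).
- exact: below_count_gt0 g0 gi0 gD.
- exact: above_count_gt0 g0 gi0 gD.
- exact: mean_gt0 g0 gD.
- exact: below_sum_ge g0 gi0 gD.
- exact: below_sqr_ge g0 gi0 gD.
- exact: above_cauchy.
- exact: below_cauchy g0 gi0 gD.
Qed.
End DimensionFive.

(** When the heights of the vertices other than [s i] are all equal, u has equal
    coordinates on the edge vectors at [s i], so it is a positive multiple of
    their sum. *)
Lemma extremal_direction n (s : 'I_n.+1 -> 'rV[R]_n) (hs : regular_simplex_vertices s)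
    (u : 'rV[R]_n) d i : (1 <= n <= 4)%N ->
  supporting (simplex s) u d -> simplex s `<=` upper_halfspace u d ->
  vol_ratio (simplex s) u d = (2 * n%:R)%:E -> hyperplane u d (s i) ->
  u = height_dir s i.
Proof.
move=> n14 su up; have n_gt0 : (0 < n)%N by case/andP: n14.
have hb := regular_barycentric n_gt0 hs; have [u1 _ _] := su.
have [h0 _] := supporting_heights n_gt0 hs su up.
rewrite (vol_ratio_heights n_gt0 hs u1 h0) => -[hr] /= ui.
have hi : dot u (s i) - d = 0 by rewrite ui subrr.
have k0 := half_edge_sqr_gt0 n_gt0 hs.
have hD := sum_dev_heights n_gt0 hs d u1.
have [|t t0 tE] := height_ratio_eq n14 h0 hi _ hr; first by rewrite hD.
pose c := (half_edge_sqr s n_gt0)^-1 * t; have c0 : 0 < c by rewrite mulr_gt0 ?invr_gt0.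
have dirE j : j != i -> bary_dir (regular_bary s n_gt0) u j = c.
  by move=> ji; rewrite (regular_bary_dir s n_gt0 u d) tE.
rewrite /height_dir; set v := \sum_(j | _) _.
have uE : u = c *: v.
  rewrite -[LHS](bary_dir_point hb u) -[LHS]subr0 -[X in _ - X](scale0r (s i)).
  rewrite -(bary_dir_sum hb u) scaler_suml -sumrB (bigD1 i) //= subrr add0r.
  by rewrite scaler_sumr; apply: eq_bigr => j ji; rewrite -scalerBr dirE.
have vE : enorm v = c^-1.
  apply: (mulfI (lt0r_neq0 c0)); rewrite divff ?lt0r_neq0 // -u1 uE.
  by rewrite /enorm dotZl dotZr mulrA -expr2 sqrtrM ?sqr_ge0 // sqrtr_sqr gtr0_norm.
by rewrite vE invrK.
Qed.
End Extremal.

Theorem theorem1 (R : realType) (n : nat) (s : 'I_n.+1 -> 'rV[R]_n)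
    (hs : regular_simplex_vertices s) :
  ((1 <= n <= 4)%N ->
     is_max (vol_ratios (simplex s)) (2 * n%:R)%:E /\
     (forall (u : 'rV[R]_n) (d : R),
        supporting (simplex s) u d ->
        simplex s `<=` upper_halfspace u d ->
        vol_ratio (simplex s) u d = (2 * n%:R)%:E ->
        (exists i, hyperplane u d (s i)) /\
        (forall i, hyperplane u d (s i) -> u = height_dir s i))) /\
  (n = 5%N ->
     let c : R := 10 * (1 / 2 + Num.sqrt 77 / (10 * Num.sqrt 3)) in
     [/\ is_max (vol_ratios (simplex s)) c%:E,
         10 < c &
         10 = 2 * n%:R :> R]).
Proof.
split=> [n14|n5].
  have n_gt0 : (0 < n)%N by case/andP: n14.
  split; last first.
    move=> u d su up ratio; split; last by move=> i; exact: extremal_direction.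
    have [_ [j hj]] := supporting_heights n_gt0 hs su up.
    by exists j; apply/eqP; rewrite -subr_eq0 hj.
  split.
    rewrite -(height_ratio_one_below R n_gt0).
    apply: (vol_ratios_mem n_gt0 hs (i0 := ord0)) => //.
    exact: dev_one_below_gt0.
  apply: (vol_ratios_ubound n_gt0 hs) => h i0 h0 hi0 hD.
  exact: height_ratio_le n14 h0 hi0 hD.
subst n; set c := 10 * _.
pose r : R := Num.sqrt 77 / Num.sqrt 3.
have s3 : 0 < Num.sqrt 3 :> R by rewrite sqrtr_gt0.
have r2 : r ^+ 2 = 77 / 3 by rewrite expr_div_n !sqr_sqrtr.
have cE : c = 5 + r by rewrite /c /r; field; rewrite lt0r_neq0.
have r0 : 0 <= r by rewrite divr_ge0 // sqrtr_ge0.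
have r5 : 5 < r by rewrite ltNge; apply/negP => r5; move: r2; rewrite expr2; nra.
pose lam := c / 2.
have c2 : c = 2 * lam by rewrite /lam mulrC divfK ?pnatr_eq0.
have lam5 : 5 < lam by rewrite /lam cE; lra.
have lamE : lam * (6 * lam - 30) = 1.
  rewrite /lam cE; transitivity (3 / 2 * r ^+ 2 - 75 / 2); first by field.
  by rewrite r2; field.
have n_gt0 : (0 < 5)%N by [].
split; last 2 first.
- by rewrite cE; lra.
- by ring.
rewrite c2; split.
  rewrite -(height_ratio_two_below lam5 lamE).
  apply: (vol_ratios_mem n_gt0 hs (i0 := ord0)).
  - exact: two_below_ge0 lamE.
  - by [].
  - exact: dev_two_below_gt0 lamE.
by apply: (vol_ratios_ubound n_gt0 hs) => h i0; exact: height_ratio_le_5 lam5 lamE _ i0.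
Qed.
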